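(* Let $\varphi:\mathbb{R}^n\to(-\infty,\infty]$ be continuously prox-regular at $\bar x$ for $\bar v=0$ and satisfy $\varphi(x)\ge\varphi(\bar x)-\frac\rho2\|x-\bar x\|^2$ for all $x\in\mathbb{R}^n$ for some $\rho\ge0$, where $\bar x$ is a tilt-stable local minimizer of $\varphi$ with modulus $\kappa>0$, and assume $\partial\varphi$ is semismooth$^*$ at $(\bar x,\bar v)$. Then for every sufficiently small $r>0$ there is $\delta>0$ such that for each starting point $x_0\in\mathbb B_\delta(\bar x)$, both Algorithm A and Algorithm B applied to the function $e_r\varphi$ (in place of $\varphi$) are well-defined, and every (infinite) sequence $\{x_k\}$ generated by either of them converges to $\bar x$ Q-superlinearly.
   Context: Moreau envelope: $e_r\varphi(x)=\inf_w\{\varphi(w)+\frac1{2r}\|w-x\|^2\}$; for small $r>0$ it is $\mathcal C^{1,1}$ near $\bar x$. For a function $\phi$ of class $\mathcal C^{1,1}$ near $\bar x$: Algorithm A: given $x_k$, if $\nabla\phi(x_k)=0$ stop; otherwise select $d_k\in\{y:-\nabla\phi(x_k)\in D^*\nabla\phi(x_k)(-y)\}$ and set $x_{k+1}:=x_k-d_k$. Algorithm B: given $x_k$, if $\nabla\phi(x_k)=0$ stop; otherwise select $d_k\in\{y:-\nabla\phi(x_k)\in D\nabla\phi(x_k)(y)\}$ and set $x_{k+1}:=x_k+d_k$. Cones: $T_\Omega(\bar x)=\{w:\exists t_k\downarrow0,w_k\to w,\bar x+t_kw_k\in\Omega\}$; $\widehat N_\Omega(\bar x)=\{v:\limsup_{x\to\bar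 x,x\in\Omega}\langle v,x-\bar x\rangle/\|x-\bar x\|\le0\}$; $N_\Omega(\bar x)$ = all limits of $v_k\in\widehat N_\Omega(x_k)$, $x_k\to\bar x$ in $\Omega$. For $F$, $DF(\bar x,\bar y)(u)=\{v:(u,v)\in T_{\operatorname{gph}F}(\bar x,\bar y)\}$, $D^*F(\bar x,\bar y)(v)=\{u:(u,-v)\in N_{\operatorname{gph}F}(\bar x,\bar y)\}$. Subdifferential $\partial\varphi(\bar x)=\{v:(v,-1)\in N_{\operatorname{epi}\varphi}(\bar x,\varphi(\bar x))\}$. Continuously prox-regular at $\bar x$ for $\bar v\in\partial\varphi(\bar x)$: $\varphi(\bar x)$ finite, $\varphi$ l.s.c. around $\bar x$, there are $\varepsilon>0,\rho'\ge0$ with $\varphi(x)\ge\varphi(u)+\langle v,x-u\rangle-\frac{\rho'}2\|x-u\|^2$ for all $x\in\mathbb B_\varepsilon(\bar x)$, $(u,v)\in\operatorname{gph}\partial\varphi\cap\mathbb B_\varepsilon(\bar x,\bar v)$, and $(x_k,v_k)\to(\bar x,\bar v)$ with $v_k\in\partial\varphi(x_k)$ implies $\varphi(x_k)\to\varphi(\bar x)$. Tilt-stable local minimizer with modulus $\kappa$: for some $\gamma>0$, $M_\gamma(v)=\operatorname{argmin}\{\varphi(x)-\langle v,x\rangle:x\in\mathbb B_\gamma(\bar x)\}$ is single-valued and $\kappa$-Lipschitz near $0$ with $M_\gamma(0)=\{\bar x\}$. Semismooth$^*$: with directional normal cone $N_{\operatorname{gph}F}((\bar x,\bar y);(u,v))$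 = all limits of $a_k\in\widehat N_{\operatorname{gph}F}((\bar x,\bar y)+t_k(u_k,v_k))$, $t_k\downarrow0$, $(u_k,v_k)\to(u,v)$, and $D^*F((\bar x,\bar y);(u,v))(w)=\{q:(q,-w)\in N_{\operatorname{gph}F}((\bar x,\bar y);(u,v))\}$, $F$ is semismooth$^*$ at $(\bar x,\bar y)$ if for all $(u,v)$, $\langle u^*,u\rangle=\langle v^*,v\rangle$ whenever $u^*\in D^*F((\bar x,\bar y);(u,v))(v^* )$. *)

(* Defs.v *)
From mathcomp Require Import all_boot all_order all_algebra.
From mathcomp Require Import all_classical all_reals ereal.
Set Implicit Arguments. Unset Strict Implicit. Unset Printing Implicit Defensive.
Import Order.TTheory GRing.Theory Num.Theory.
Local Open Scope ring_scope.

Section Defs.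
Variable R : realType.

Definition dotv n (u v : 'rV[R]_n) : R := \sum_(i < n) u 0 i * v 0 i.
Definition normv n (u : 'rV[R]_n) : R := Num.sqrt (dotv u u).

Definition cvgv n (x : nat -> 'rV[R]_n) (l : 'rV[R]_n) : Prop :=
  forall eps : R, 0 < eps -> exists N : nat, forall k, (N <= k)%N -> normv (x k - l) < eps.
Definition cvgR (a : nat -> R) (l : R) : Prop :=
  forall eps : R, 0 < eps -> exists N : nat, forall k, (N <= k)%N -> `|a k - l| < eps.
Definition down0 (t : nat -> R) : Prop := (forall k, 0 < t k) /\ cvgR t 0.

Definition pairv n m (u : 'rV[R]_n) (v : 'rV[R]_m) : 'rV[R]_(n + m) := row_mx u v.

Definition Tcone m (Om : set 'rV[R]_m) (xb w : 'rV[R]_m) : Prop :=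
  exists (t : nat -> R) (wk : nat -> 'rV[R]_m),
    down0 t /\ cvgv wk w /\ forall k, Om (xb + t k *: wk k).

Definition Nhat m (Om : set 'rV[R]_m) (xb v : 'rV[R]_m) : Prop :=
  Om xb /\ forall eps : R, 0 < eps -> exists delta : R, 0 < delta /\
    forall x, Om x -> x != xb -> normv (x - xb) < delta ->
      dotv v (x - xb) <= eps * normv (x - xb).

Definition Ncone m (Om : set 'rV[R]_m) (xb v : 'rV[R]_m) : Prop :=
  exists (xk vk : nat -> 'rV[R]_m),
    (forall k, Om (xk k)) /\ cvgv xk xb /\ cvgv vk v /\ forall k, Nhat Om (xk k) (vk k).

Definition Ndir m (Om : set 'rV[R]_m) (xb d a : 'rV[R]_m) : Prop :=
  exists (t : nat -> R) (dk ak : nat -> 'rV[R]_m),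
    down0 t /\ cvgv dk d /\ cvgv ak a /\ forall k, Nhat Om (xb + t k *: dk k) (ak k).

Definition gph n (F : 'rV[R]_n -> 'rV[R]_n -> Prop) : set 'rV[R]_(n + n) :=
  [set z | exists x y, z = pairv x y /\ F x y].

Definition graphD n (F : 'rV[R]_n -> 'rV[R]_n -> Prop) (x y u v : 'rV[R]_n) : Prop :=
  Tcone (gph F) (pairv x y) (pairv u v).
Definition coderiv n (F : 'rV[R]_n -> 'rV[R]_n -> Prop) (x y v u : 'rV[R]_n) : Prop :=
  Ncone (gph F) (pairv x y) (pairv u (- v)).
Definition coderiv_dir n (F : 'rV[R]_n -> 'rV[R]_n -> Prop) (x y u v w q : 'rV[R]_n) : Prop :=
  Ndir (gph F) (pairv x y) (pairv u v) (pairv q (- w)).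

Definition semismooth_star n (F : 'rV[R]_n -> 'rV[R]_n -> Prop) (x y : 'rV[R]_n) : Prop :=
  forall u v us vs : 'rV[R]_n, coderiv_dir F x y u v vs us -> dotv us u = dotv vs v.

Local Open Scope ereal_scope.

Definition epi n (phi : 'rV[R]_n -> \bar R) : set 'rV[R]_(n + 1) :=
  [set z | exists (x : 'rV[R]_n) (a : R), z = pairv x (const_mx a) /\ phi x <= a%:E].

Definition subdiff n (phi : 'rV[R]_n -> \bar R) (x v : 'rV[R]_n) : Prop :=
  exists a : R, phi x = a%:E /\
    Ncone (epi phi) (pairv x (const_mx a)) (pairv v (const_mx (-1)%R)).

Definition lsc_at n (phi : 'rV[R]_n -> \bar R) (y : 'rV[R]_n) : Prop :=
  forall a : \bar R, a < phi y -> exists delta : R, (0 < delta)%R /\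
    forall z, (normv (z - y) < delta)%R -> a < phi z.

Definition cont_prox_regular n (phi : 'rV[R]_n -> \bar R) (xb vb : 'rV[R]_n) : Prop :=
  subdiff phi xb vb /\
  (exists ab : R, phi xb = ab%:E) /\
  (exists eta : R, (0 < eta)%R /\ forall y, (normv (y - xb) < eta)%R -> lsc_at phi y) /\
  (exists (eps rho' : R), (0 < eps)%R /\ (0 <= rho')%R /\
     forall x u v (a : R), (normv (x - xb) <= eps)%R ->
       (normv (pairv u v - pairv xb vb) <= eps)%R -> subdiff phi u v -> phi u = a%:E ->
       ((a + dotv v (x - u) - rho' / 2%:R * normv (x - u) ^+ 2)%R)%:E <= phi x) /\
  (forall (xk vk : nat -> 'rV[R]_n) (ak : nat -> R) (ab : R),
     cvgv xk xb -> cvgv vk vb -> phi xb = ab%:E ->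
     (forall k, subdiff phi (xk k) (vk k) /\ phi (xk k) = (ak k)%:E) ->
     cvgR ak ab).

Definition Mtilt n (phi : 'rV[R]_n -> \bar R) (xb : 'rV[R]_n) (gamma : R) (v x : 'rV[R]_n) : Prop :=
  (normv (x - xb) <= gamma)%R /\
  forall y, (normv (y - xb) <= gamma)%R ->
    phi x - (dotv v x)%:E <= phi y - (dotv v y)%:E.

Definition tilt_stable n (phi : 'rV[R]_n -> \bar R) (xb : 'rV[R]_n) (kappa : R) : Prop :=
  exists gamma : R, (0 < gamma)%R /\
  exists eta : R, (0 < eta)%R /\
  exists m : 'rV[R]_n -> 'rV[R]_n,
    (forall v, (normv v < eta)%R -> forall x, Mtilt phi xb gamma v x <-> x = m v) /\
    (forall v w, (normv v < eta)%R -> (normv w < eta)%R ->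
        (normv (m v - m w) <= kappa * normv (v - w))%R) /\
    m 0%R = xb.

Definition moreau n (r : R) (phi : 'rV[R]_n -> \bar R) (x : 'rV[R]_n) : \bar R :=
  ereal_inf [set phi w + ((2%:R * r)^-1 * normv (w - x) ^+ 2)%R%:E | w in [set: 'rV[R]_n]].

Definition is_grad n (f : 'rV[R]_n -> \bar R) (x g : 'rV[R]_n) : Prop :=
  exists a : R, f x = a%:E /\
  forall eps : R, (0 < eps)%R -> exists delta : R, (0 < delta)%R /\
    forall y, (normv (y - x) < delta)%R ->
      exists b : R, f y = b%:E /\
        (`|b - a - dotv g (y - x)| <= eps * normv (y - x))%R.

Local Close Scope ereal_scope.

Definition stepA n (f : 'rV[R]_n -> \bar R) (x x' : 'rV[R]_n) : Prop :=
  exists g, is_grad f x g /\ g != 0 /\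
  exists d, coderiv (is_grad f) x g (- d) (- g) /\ x' = x - d.
Definition stepB n (f : 'rV[R]_n -> \bar R) (x x' : 'rV[R]_n) : Prop :=
  exists g, is_grad f x g /\ g != 0 /\
  exists d, graphD (is_grad f) x g d (- g) /\ x' = x + d.

(* the algorithm with step relation "step" is well defined from x0:
   at every iterate the gradient exists, and a direction exists unless it stops *)
Definition alg_well_defined n (step : 'rV[R]_n -> 'rV[R]_n -> Prop)
    (f : 'rV[R]_n -> \bar R) (x0 : 'rV[R]_n) : Prop :=
  forall (x : nat -> 'rV[R]_n) (k : nat), x 0%N = x0 ->
    (forall j, (j < k)%N -> step (x j) (x j.+1)) ->
    exists g, is_grad f (x k) g /\ (g != 0 -> exists y, step (x k) y).

Definition Qsuperlinear n (x : nat -> 'rV[R]_n) (xb : 'rV[R]_n) : Prop :=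
  cvgv x xb /\
  forall eps : R, 0 < eps -> exists N : nat, forall k, (N <= k)%N ->
    normv (x k.+1 - xb) <= eps * normv (x k - xb).

End Defs.

(* Main.v *)
Require Import Defs.
From mathcomp Require Import all_boot all_order all_algebra.
From mathcomp Require Import all_classical all_reals ereal.
From mathcomp Require Import ring lra.
Import Order.TTheory GRing.Theory Num.Theory.
Local Open Scope ring_scope.
Set Implicit Arguments. Unset Strict Implicit. Unset Printing Implicit Defensive.

(* Let m be the tilt map, v |-> argmin (phi - <v, .>) near xb.  It is Lipschitz
   and it is a subgradient map of a convex function g (a conjugate of phi), so
   v |-> m v + r v is onto a neighbourhood of xb; the point m v is the global
   minimiser in the definition of e_r phi at x = m v + r v, hence e_r phi has
   gradient v there.  Thus the graph of grad e_r phi near xb is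
   {(m v + r v, v)}, while by prox-regularity that of the subdifferential of
   phi near (xb, 0) is {(m v, v)}.

   Take xb = 0.  Applied to the subgradients of the functions <a, m>, a mean
   value argument turns semismoothness into approximate radial homogeneity:
   |S m(v/S) - m v| <= eps (S - 1) |v| for S >= 1 and v small.  This gives
   directly the superlinear estimate for steps along the graphical derivative.
   Since m is a gradient, it also implies that chi v = 2 g v - <m v, v> is
   Lipschitz with constant eps |v|, that is,
   <m v' - m v, v> = <m v, v' - v> up to eps |v| |v' - v|: an approximate
   symmetry of the derivative which yields the estimate for coderivative steps
   without differentiating m almost everywhere. *)

(** * Euclidean vectors *)

Section EuclideanVectors.
Context {R : realType}.

Section Dimension.
Context {n : nat}.
Implicit Types (u v w x y : 'rV[R]_n) (a : R).

Lemma dotvC u v : dotv u v = dotv v u.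
Proof. by apply: eq_bigr => i _; rewrite mulrC. Qed.

Lemma dotvDl u v w : dotv (u + v) w = dotv u w + dotv v w.
Proof. by rewrite -big_split; apply: eq_bigr => i _; rewrite mxE mulrDl. Qed.

Lemma dotvZl a u w : dotv (a *: u) w = a * dotv u w.
Proof. by rewrite mulr_sumr; apply: eq_bigr => i _; rewrite mxE mulrA. Qed.

Lemma dotvDr u v w : dotv w (u + v) = dotv w u + dotv w v.
Proof. by rewrite !(dotvC w) dotvDl. Qed.

Lemma dotvZr a u w : dotv w (a *: u) = a * dotv w u.
Proof. by rewrite !(dotvC w) dotvZl. Qed.

Lemma dotvNl u w : dotv (- u) w = - dotv u w.
Proof. by rewrite -scaleN1r dotvZl mulN1r. Qed.

Lemma dotvNr u w : dotv w (- u) = - dotv w u.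
Proof. by rewrite !(dotvC w) dotvNl. Qed.

Lemma dot0v u : dotv 0 u = 0.
Proof. by rewrite -(scale0r 0) dotvZl mul0r. Qed.

Lemma dotv0 u : dotv u 0 = 0.
Proof. by rewrite dotvC dot0v. Qed.

Definition dotvE := (dotvDl, dotvDr, dotvNl, dotvNr, dotvZl, dotvZr).

Lemma dotv_ge0 u : 0 <= dotv u u.
Proof. by apply: sumr_ge0 => i _; rewrite -expr2 sqr_ge0. Qed.

Lemma dotv_eq0 u : (dotv u u == 0) = (u == 0).
Proof.
apply/idP/eqP => [|->]; last by rewrite dot0v.
rewrite psumr_eq0 => [/allP h|i _]; last by rewrite -expr2 sqr_ge0.
apply/rowP => i; rewrite mxE; apply/eqP.
by have := h i (mem_index_enum i); rewrite -expr2 sqrf_eq0.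
Qed.

Lemma normv_ge0 u : 0 <= normv u.
Proof. exact: sqrtr_ge0. Qed.

Lemma normv_sqr u : normv u ^+ 2 = dotv u u.
Proof. by rewrite sqr_sqrtr ?dotv_ge0. Qed.

Lemma normv0 : normv (0 : 'rV[R]_n) = 0.
Proof. by rewrite /normv dot0v sqrtr0. Qed.

Lemma normv_eq0 u : (normv u == 0) = (u == 0).
Proof. by rewrite -dotv_eq0 -normv_sqr sqrf_eq0. Qed.

Lemma normv_gt0 u : (0 < normv u) = (u != 0).
Proof. by rewrite lt_def normv_eq0 normv_ge0 andbT. Qed.

Lemma normv_le u a : 0 <= a -> (normv u <= a) = (dotv u u <= a ^+ 2).
Proof. by move=> a0; rewrite -normv_sqr ler_sqr// nnegrE normv_ge0. Qed.

Lemma normvZ a u : normv (a *: u) = `|a| * normv u.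
Proof.
by rewrite /normv !dotvE mulrA -expr2 sqrtrM ?sqr_ge0// sqrtr_sqr.
Qed.

Lemma normvZ_ge0 a u : 0 <= a -> normv (a *: u) = a * normv u.
Proof. by move=> a0; rewrite normvZ ger0_norm. Qed.

Lemma normvN u : normv (- u) = normv u.
Proof. by rewrite -scaleN1r normvZ normrN1 mul1r. Qed.

Lemma normvBC u v : normv (u - v) = normv (v - u).
Proof. by rewrite -normvN opprB. Qed.

Lemma dotv_le_norm u v : dotv u v <= normv u * normv v.
Proof.
have [->|v0] := eqVneq v 0; first by rewrite dotv0 normv0 mulr0.
have [->|u0] := eqVneq u 0; first by rewrite dot0v normv0 mul0r.
have := dotv_ge0 (normv v *: u - normv u *: v).
rewrite !dotvE -!normv_sqr (dotvC v u) => h.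
move: u0 v0; rewrite -!normv_gt0 => u0 v0.
have uv0 := mulr_gt0 u0 v0; rewrite -(ler_pM2l uv0); nra.
Qed.

Lemma normr_dotv u v : `|dotv u v| <= normv u * normv v.
Proof.
rewrite ler_norml dotv_le_norm andbT lerNl -dotvNl -(normvN u).
exact: dotv_le_norm.
Qed.

Lemma normvD u v : normv (u + v) <= normv u + normv v.
Proof.
rewrite normv_le ?addr_ge0 ?normv_ge0// !dotvE -!normv_sqr (dotvC v u).
have := dotv_le_norm u v; nra.
Qed.

Lemma normvB u v : normv (u - v) <= normv u + normv v.
Proof. by rewrite -(normvN v) normvD. Qed.

Lemma normv_tri u v w : normv (u - w) <= normv (u - v) + normv (v - w).
Proof. by apply: le_trans (normvD _ _); rewrite addrA subrK. Qed.

Lemma normv_triB u v : normv u <= normv (u - v) + normv v.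
Proof. by apply: le_trans (normvD _ _); rewrite subrK. Qed.

Lemma normr_coord u i : `|u 0 i| <= normv u.
Proof.
rewrite -(ler_sqr (normr_ge0 _)) ?nnegrE ?normv_ge0//.
rewrite normv_sqr real_normK ?num_real// /dotv (bigD1 i)//= -expr2.
by rewrite lerDl sumr_ge0// => j _; rewrite -expr2 sqr_ge0.
Qed.

Lemma normv_le_sum u : normv u <= \sum_(i < n) `|u 0 i|.
Proof.
rewrite {1}(row_sum_delta u); elim/big_ind2: _ => [|a x b y ax by'|i _].
- by rewrite normv0.
- exact: le_trans (normvD _ _) (lerD ax by').
- rewrite normvZ ler_piMr// normv_le// expr1n /dotv (bigD1 i)//= big1 => [|j ji].
    by rewrite mxE !eqxx/= mulr1 addr0.
  by rewrite mxE (negPf ji) andbF mul0r.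
Qed.

(** A bound at one small multiple of u suffices, since dividing by t |u| gives |u| <= K + eps.
    First-order conditions are exploited below in this single direction. *)
Lemma normv_le_of_small (u : 'rV[R]_n) (K : R) : 0 <= K ->
  (forall eps, 0 < eps -> exists t, 0 < t /\
     dotv u (t *: u) <= (K + eps) * normv (t *: u)) ->
  normv u <= K.
Proof.
move=> K0 h; apply/ler_addgt0Pr => e e0; have [t [t0]] := h e e0.
rewrite dotvZr normvZ_ge0 ?(ltW t0)// -normv_sqr => H.
have [->|] := eqVneq u 0; first by rewrite normv0; lra.
rewrite -normv_gt0 => u0; rewrite -(ler_pM2l (mulr_gt0 t0 u0)); nra.
Qed.

End Dimension.

Lemma dotv_pair n m (u u' : 'rV[R]_n) (v v' : 'rV[R]_m) :
  dotv (pairv u v) (pairv u' v') = dotv u u' + dotv v v'.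
Proof.
by rewrite /dotv big_split_ord; congr (_ + _); apply: eq_bigr => i _;
  rewrite ?row_mxEl ?row_mxEr.
Qed.

Lemma pairvB n m (u u' : 'rV[R]_n) (v v' : 'rV[R]_m) :
  pairv u v - pairv u' v' = pairv (u - u') (v - v').
Proof. by rewrite /pairv opp_row_mx add_row_mx. Qed.

Lemma pairvDZ n m t (u u' : 'rV[R]_n) (v v' : 'rV[R]_m) :
  pairv u v + t *: pairv u' v' = pairv (u + t *: u') (v + t *: v').
Proof. by rewrite /pairv scale_row_mx add_row_mx. Qed.

Lemma normv_pair_le n m (u : 'rV[R]_n) (v : 'rV[R]_m) :
  normv (pairv u v) <= normv u + normv v.
Proof.
rewrite normv_le ?addr_ge0 ?normv_ge0// dotv_pair -!normv_sqr.
have := normv_ge0 u; have := normv_ge0 v; nra.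
Qed.

Lemma normv_pairl n m (u : 'rV[R]_n) (v : 'rV[R]_m) :
  normv u <= normv (pairv u v).
Proof.
by rewrite normv_le ?normv_ge0// normv_sqr dotv_pair lerDl dotv_ge0.
Qed.

Lemma normv_pairr n m (u : 'rV[R]_n) (v : 'rV[R]_m) :
  normv v <= normv (pairv u v).
Proof.
by rewrite normv_le ?normv_ge0// normv_sqr dotv_pair lerDr dotv_ge0.
Qed.

End EuclideanVectors.

(** * Sequences and compactness *)

Section Compactness.
Context {R : realType}.

Definition invn (k : nat) : R := k.+1%:R^-1.

Lemma invn_gt0 k : 0 < invn k.
Proof. by rewrite invr_gt0. Qed.

Lemma invn_lt (e : R) : 0 < e ->
  exists N, forall k, (N <= k)%N -> invn k < e.
Proof.
rewrite /invn => e0; exists (Num.trunc e^-1) => k Nk.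
rewrite invf_plt ?posrE ?ltr0n//; apply: lt_le_trans (truncnS_gt _) _.
by rewrite ler_nat ltnS.
Qed.

Lemma cvgv_cst n (l : 'rV[R]_n) : cvgv (fun=> l) l.
Proof. by move=> e e0; exists 0%N => k _; rewrite subrr normv0. Qed.

Lemma cvgv_sub n (u : nat -> 'rV[R]_n) l (s : nat -> nat) :
  (forall k, (k <= s k)%N) -> cvgv u l -> cvgv (u \o s) l.
Proof.
by move=> sk ul e /ul[N h]; exists N => k Nk; apply/h/(leq_trans Nk).
Qed.

Lemma cvgR_sub (u : nat -> R) l (s : nat -> nat) :
  (forall k, (k <= s k)%N) -> cvgR u l -> cvgR (u \o s) l.
Proof.
by move=> sk ul e /ul[N h]; exists N => k Nk; apply/h/(leq_trans Nk).
Qed.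

Lemma cvgv_pair n m (u : nat -> 'rV[R]_n) (v : nat -> 'rV[R]_m) l l' :
  cvgv u l -> cvgv v l' -> cvgv (fun k => pairv (u k) (v k)) (pairv l l').
Proof.
move=> ul vl e e0; have e20 : 0 < e / 2%:R by lra.
have [N h] := ul _ e20; have [N' h'] := vl _ e20.
exists (maxn N N') => k; rewrite geq_max => /andP[/h a /h' b].
rewrite pairvB; apply: (le_lt_trans (normv_pair_le _ _)); lra.
Qed.

Lemma cvgv_pairl n m (u : nat -> 'rV[R]_n) (v : nat -> 'rV[R]_m) l l' :
  cvgv (fun k => pairv (u k) (v k)) (pairv l l') -> cvgv u l.
Proof.
move=> h e /h[N H]; exists N => k /H; rewrite pairvB; apply: le_lt_trans.
exact: normv_pairl.
Qed.

Lemma cvgv_pairr n m (u : nat -> 'rV[R]_n) (v : nat -> 'rV[R]_m) l l' :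
  cvgv (fun k => pairv (u k) (v k)) (pairv l l') -> cvgv v l'.
Proof.
move=> h e /h[N H]; exists N => k /H; rewrite pairvB; apply: le_lt_trans.
exact: normv_pairr.
Qed.

Lemma cvgv_le n (u : nat -> 'rV[R]_n) l x M : cvgv u l ->
  (forall k, normv (u k - x) <= M) -> normv (l - x) <= M.
Proof.
move=> ul uM; apply/ler_addgt0Pr => e /ul[N /(_ N (leqnn _))].
have := normv_tri l (u N) x; have := uM N; rewrite (normvBC l (u N)); lra.
Qed.

Lemma cvgR_dotv n (a d : nat -> 'rV[R]_n) a0 d0 : cvgv a a0 -> cvgv d d0 ->
  cvgR (fun k => dotv (a k) (d k)) (dotv a0 d0).
Proof.
move=> ha hd e e0; pose M := 1 + normv a0 + normv d0.
have M0 : 1 <= M by rewrite /M -addrA lerDl addr_ge0 ?normv_ge0.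
have r0 : 0 < Num.min 1 (e / (2%:R * M)).
  by rewrite lt_min ltr01 divr_gt0//; lra.
have [N h] := ha _ r0; have [N' h'] := hd _ r0.
exists (maxn N N') => k; rewrite geq_max => /andP[/h + /h'].
rewrite !lt_min !ltr_pdivlMr; [|lra..] => /andP[a1 aM] /andP[d1 dM].
have -> : dotv (a k) (d k) - dotv a0 d0 =
    dotv (a k - a0) (d k) + dotv a0 (d k - d0). rewrite !dotvE. ring.
apply: le_lt_trans (ler_normD _ _) _.
have A := normr_dotv (a k - a0) (d k); have D := normr_dotv a0 (d k - d0).
have dk := normv_triB (d k) d0.
have a0M : normv a0 <= M by rewrite /M; have := normv_ge0 d0; lra.
have dkM : normv (d k) <= M by rewrite /M; have := normv_ge0 a0; lra.
have := ler_wpM2l (normv_ge0 (a k - a0)) dkM.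
have := ler_wpM2r (normv_ge0 (d k - d0)) a0M; lra.
Qed.

(** The limsup is a cluster value: it is the supremum of the numbers that the sequence reaches or
    exceeds infinitely often. *)
Lemma cluster_real (u : nat -> R) M : (forall k, `|u k| <= M) ->
  exists l, forall e, 0 < e -> forall N, exists k, (N <= k)%N /\ `|u k - l| < e.
Proof.
move=> uM; pose A := [set a | forall N, exists k, (N <= k)%N /\ a <= u k]%classic.
have A0 : A (- M).
  by move=> N; exists N; split=> //; have := uM N; rewrite ler_norml => /andP[].
have Aub : has_ubound A.
  exists M => a /(_ 0%N)[k [_ /le_trans]]; apply.
  by have := uM k; rewrite ler_norml => /andP[].
have As : has_sup A by split; [exists (- M)|].
exists (sup A) => e e0 N.
have [N' hN'] : exists N', forall k, (N' <= k)%N -> u k < sup A + e.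
  apply: contrapT => h.
  suff : A (sup A + e) by move/(ub_le_sup Aub); rewrite gerDl leNgt e0.
  move=> P; apply: contrapT => h'; apply: h; exists P => k Pk.
  by rewrite ltNge; apply/negP => uk; apply: h'; exists k.
have [a Aa sa] := sup_adherent e0 As.
have [k [Nk ak]] := Aa (maxn N N'); move: Nk; rewrite geq_max => /andP[Nk N'k].
exists k; split=> //; rewrite ltr_norml; have := hN' _ N'k; lra.
Qed.

(** Coordinates are treated one after another. The explicit rate [invn k] survives every later
    extraction because the selections satisfy k <= s k. *)
Lemma extract_coords n (u : nat -> 'rV[R]_n) M j : (forall k, normv (u k) <= M) ->
  exists s : nat -> nat, (forall k, (k <= s k)%N) /\
    forall i : 'I_n, (i < j)%N ->
      exists a, forall k, `|u (s k) 0 i - a| <= invn k.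
Proof.
move=> uM; elim: j => [|j [s [sk IH]]]; first by exists id.
have [jn|nj] := ltnP j n; last first.
  exists s; split=> // i _; apply: IH; exact: leq_trans (ltn_ord i) nj.
have [|l hl] := @cluster_real (fun k => u (s k) 0 (Ordinal jn)) M.
  by move=> k; apply: le_trans (normr_coord _ _) _.
have /choice[t ht] : forall k, exists k', (k <= k')%N /\
    `|u (s k') 0 (Ordinal jn) - l| < invn k.
  by move=> k; apply: hl; apply: invn_gt0.
exists (s \o t); split=> [k|i].
  by apply: leq_trans (sk _); case: (ht k).
rewrite ltnS leq_eqVlt => /predU1P[ij|/IH[a ha]].
  have -> : i = Ordinal jn by exact/val_inj.
  by exists l => k; apply/ltW; case: (ht k).
exists a => k; apply: le_trans (ha _) _.
by rewrite lef_pV2 ?posrE ?ltr0n// ler_nat ltnS; case: (ht k).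
Qed.

Lemma bolzano_weierstrass n (u : nat -> 'rV[R]_n) M : (forall k, normv (u k) <= M) ->
  exists (s : nat -> nat) l, (forall k, (k <= s k)%N) /\ cvgv (u \o s) l.
Proof.
move=> uM; have [s [sk h]] := extract_coords n uM; exists s.
have /choice[l hl] : forall i : 'I_n, exists a,
    forall k, `|u (s k) 0 i - a| <= invn k by move=> i; apply: h.
exists (\row_i l i); split=> // e e0.
have [|N hN] := @invn_lt (e / n.+1%:R); first by rewrite divr_gt0.
exists N => k /hN; rewrite ltr_pdivlMr ?ltr0n// => H.
apply: le_lt_trans H; apply: le_trans (normv_le_sum _) _.
apply: (@le_trans _ _ (\sum_(i < n) invn k)).
  by apply: ler_sum => i _; rewrite !mxE; apply: hl.
rewrite sumr_const card_ord -[leLHS]mulr_natr ler_wpM2l ?(ltW (invn_gt0 k))//.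
by rewrite ler_nat.
Qed.

(** Weierstrass's theorem, with compactness and lower semicontinuity merged into one condition on
    sequences in K. The infimum is treated as minus the supremum of - f. *)
Lemma argmin_exists (T : Type) (K : T -> Prop) (f : T -> R) : (exists x, K x) ->
  (forall u : nat -> T, (forall k, K (u k)) -> exists2 l, K l &
     forall (e : R) N, 0 < e -> exists2 k, (N <= k)%N & f l <= f (u k) + e) ->
  exists2 x, K x & forall y, K y -> f x <= f y.
Proof.
move=> [x0 Kx0] comp; pose A := [set - f x | x in [set x | K x]]%classic.
have A0 : (A !=set0)%classic by exists (- f x0), x0.
have Aub : has_ubound A.
  apply: contrapT => h.
  have /choice[u hu] : forall k, exists x, K x /\ f x < - k%:R.
    move=> k; apply: contrapT => h'; apply: h; exists k%:R => _ [x /= Kx <-].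
    by rewrite lerNl leNgt; apply/negP => fx; apply: h'; exists x.
  have [|l Kl hl] := comp u; first by move=> k; case: (hu k).
  have [k Nk lk] := hl 1 (Num.trunc (`|f l| + 1)).+1 ltr01.
  have [_ uk] := hu k; have := truncnS_gt (`|f l| + 1).
  have : (Num.trunc (`|f l| + 1)).+1%:R <= k%:R :> R by rewrite ler_nat.
  have := ler_norm (- f l); rewrite normrN; lra.
have As : has_sup A by [].
have /choice[u hu] : forall k, exists x, K x /\ f x < - sup A + invn k.
  move=> k; have [_ [x /= Kx <-] fx] := sup_adherent (invn_gt0 k) As.
  by exists x; split=> //; lra.
have [|l Kl hl] := comp u; first by move=> k; case: (hu k).
exists l => // y Ky; apply/ler_addgt0Pr => e e0.
have e20 : 0 < e / 2%:R by lra.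
have [N hN] := invn_lt e20.
have [k /hN kN lk] := hl _ N e20; have [_ uk] := hu k.
have fy : - f y <= sup A by apply: ub_le_sup => //; exists y.
lra.
Qed.

Lemma argmin_compact n (K : 'rV[R]_n -> Prop) (f : 'rV[R]_n -> R) M C :
  (exists x, K x) -> (forall x, K x -> normv x <= M) ->
  (forall u l, (forall k, K (u k)) -> cvgv u l -> K l) ->
  (forall x y, K x -> K y -> f x - f y <= C * normv (x - y)) ->
  exists2 x, K x & forall y, K y -> f x <= f y.
Proof.
move=> K0 KM Kcl fC; apply: argmin_exists => // u uK.
have [|s [l [sk ul]]] := @bolzano_weierstrass _ u M; first by move=> k; apply: KM.
have lK : K l by apply: Kcl ul => k; apply: uK.
exists l => // e N e0.
have [|N' hN'] := ul (e / (`|C| + 1)); first by rewrite divr_gt0// ltr_wpDl.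
pose k := maxn N N'.
have := hN' k (leq_maxr _ _); rewrite ltr_pdivlMr ?ltr_wpDl//= => H.
exists (s k); first by apply: leq_trans (sk _); apply: leq_maxl.
have := fC _ _ lK (uK (s k)); rewrite (normvBC l).
have := ler_norm C; have := normv_ge0 (u (s k) - l); nra.
Qed.

Lemma argmin_ball n (x0 : 'rV[R]_n) r (f : 'rV[R]_n -> R) C : 0 <= r ->
  (forall x y, normv (x - x0) <= r -> normv (y - x0) <= r ->
     f x - f y <= C * normv (x - y)) ->
  exists2 x, normv (x - x0) <= r &
    forall y, normv (y - x0) <= r -> f x <= f y.
Proof.
move=> r0; apply: (@argmin_compact _ _ _ (r + normv x0)).
- by exists x0; rewrite subrr normv0.
- by move=> x; have := normv_triB x x0; lra.
- by move=> u l uK /cvgv_le; apply.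
Qed.

End Compactness.

(** * Semismoothness and subgradients *)

Section Semismooth.
Context {R : realType}.

Lemma Nhat_scale m (Om : set 'rV[R]_m) z a (c : R) : 0 < c ->
  Nhat Om z a -> Nhat Om z (c *: a).
Proof.
move=> c0 [Oz h]; split=> // e e0.
have [|d [d0 hd]] := h (e / c); first by rewrite divr_gt0.
exists d; split=> // x Ox xz xd; have := hd x Ox xz xd.
by rewrite dotvZl -(ler_pM2l c0) mulrA mulrCA divff ?mulr1 ?gt_eqF.
Qed.

(** Compactness turns the identity into a uniform estimate: violating pairs, rescaled to unit
    length, subconverge to a direction d and a directional normal a with |<a, d>| >= e. *)
Lemma Ndir_uniform m (Om : set 'rV[R]_m) z0 :
  (forall d a, Ndir Om z0 d a -> dotv a d = 0) ->
  forall e : R, 0 < e -> exists2 del : R, 0 < del & forall z a,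
    normv (z - z0) < del -> Nhat Om z a ->
    `|dotv a (z - z0)| <= e * normv a * normv (z - z0).
Proof.
move=> hN e e0; apply: contrapT => hcon.
have /choice[za hza] : forall k, exists za : 'rV[R]_m * 'rV[R]_m,
    [/\ normv (za.1 - z0) < invn k, Nhat Om za.1 za.2 &
     e * normv za.2 * normv (za.1 - z0) < `|dotv za.2 (za.1 - z0)|].
  move=> k; apply: contrapT => h; apply: hcon; exists (invn k); first exact: invn_gt0.
  move=> z a zk az; rewrite leNgt; apply/negP => H; apply: h.
  by exists (z, a).
pose t k := normv ((za k).1 - z0); pose s k := normv (za k).2.
(* The violated inequality is strict, which excludes z = z0 and a = 0, so both vectors can be
   normalised. *)
have ts k : 0 < t k /\ 0 < s k.
  have [_ _ H] := hza k.
  have := lt_le_trans H (normr_dotv _ _); rewrite -/(t k) -/(s k) => {}H.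
  split; rewrite lt_def normv_ge0 andbT; apply: contraTneq H => ->.
    by rewrite !mulr0 ltxx.
  by rewrite !(mulr0, mul0r) ltxx.
pose d k := (t k)^-1 *: ((za k).1 - z0); pose a k := (s k)^-1 *: (za k).2.
have d1 k : normv (d k) = 1.
  have [t0 _] := ts k.
  by rewrite normvZ_ge0 ?invr_ge0 ?ltW// mulVf// gt_eqF.
have a1 k : normv (a k) = 1.
  have [_ s0] := ts k.
  by rewrite normvZ_ge0 ?invr_ge0 ?ltW// mulVf// gt_eqF.
have [|f [l [fk ul]]] := @bolzano_weierstrass _ _ (fun k => pairv (d k) (a k)) 2%:R.
  by move=> k; apply: le_trans (normv_pair_le _ _) _; rewrite d1 a1.
move: ul; rewrite -[l]hsubmxK => ul.
have dl := cvgv_pairl ul; have al := cvgv_pairr ul.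
have /hN lim0 : Ndir Om z0 (lsubmx l) (rsubmx l).
  exists (t \o f), (d \o f), (a \o f).
  split; first split=> [k|]; [|..|split; first exact: dl; split=> [|k]; first exact: al].
  - by case: (ts (f k)).
  - apply: cvgR_sub => // eps /invn_lt[N hN']; exists N => k /hN' kN.
    rewrite subr0 ger0_norm ?normv_ge0//; apply: lt_trans kN.
    by case: (hza k).
  - have [t0 s0] := ts (f k).
    rewrite /= scalerA divff ?gt_eqF// scale1r addrC subrK.
    by apply: Nhat_scale; rewrite ?invr_gt0//; case: (hza (f k)).
have [N] := cvgR_dotv al dl e0.
move=> /(_ N (leqnn _)); rewrite lim0 subr0 /=.
have [_ _] := hza (f N); have [t0 s0] := ts (f N).
rewrite /a /d dotvZl dotvZr !normrM !normfV (gtr0_norm s0) (gtr0_norm t0).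
rewrite -/(t _) -/(s _) !ltr_pdivrMl// => H /(lt_trans H).
by rewrite mulrC [e * _]mulrC mulrA ltxx.
Qed.

(** The pair (y, s) is encoded as a vector with n + 1 coordinates so that Euclidean compactness
    applies; the work lies in the Lipschitz bound for the objective. *)
Lemma penalized_argmin n (f : 'rV[R]_n -> R) (L c k : R) v S r :
  0 <= L -> 0 <= k -> 1 <= S -> normv v <= r ->
  (forall x y, normv x <= r -> normv y <= r -> f x - f y <= L * normv (x - y)) ->
  exists y s, [/\ normv y <= r, 1 <= s <= S &
    forall y' s', normv y' <= r -> 1 <= s' <= S ->
    s * f y - c * s + k * normv (s *: y - v) ^+ 2 <=
    s' * f y' - c * s' + k * normv (s' *: y' - v) ^+ 2].
Proof.
move=> L0 k0 S1 vr fL.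
have r0 : 0 <= r := le_trans (normv_ge0 v) vr.
pose K (z : 'rV[R]_(n + 1)) :=
  normv (lsubmx z) <= r /\ 1 <= rsubmx z 0 0 <= S.
pose J (z : 'rV[R]_(n + 1)) := let y := lsubmx z in let s := rsubmx z 0 0 in
  s * f y - c * s + k * normv (s *: y - v) ^+ 2.
have subB (z z' : 'rV[R]_(n + 1)) : normv (lsubmx z - lsubmx z') <= normv (z - z')
    /\ `|rsubmx z 0 0 - rsubmx z' 0 0| <= normv (z - z').
  have -> : z - z' = pairv (lsubmx z - lsubmx z') (rsubmx z - rsubmx z').
    by rewrite -pairvB /pairv !hsubmxK.
  split; first exact: normv_pairl.
  apply: le_trans (normv_pairr _ _).
  by apply: le_trans (normr_coord _ 0); rewrite !mxE.
have S0 : 0 <= S by lra.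
(* The constant adds up [T1] to [T4]: the change of y inside f, the change of the factor s, the
   linear term and the penalty. *)
have JL z z' : K z -> K z' -> J z - J z' <=
    (S * L + `|f v| + L * (2%:R * r) + `|c| + k * ((S + r) * (2%:R * (S * r + r)))) * normv (z - z').
  rewrite /K /J; have [] := subB z z'.
  move: (lsubmx z) (lsubmx z') (rsubmx z 0 0) (rsubmx z' 0 0) => y y' s s' yy ss.
  move: (normv (z - z')) yy ss => D yy ss [yr /andP[s1 sS]] [y'r /andP[s'1 s'S]].
  have -> : s * f y - c * s + k * normv (s *: y - v) ^+ 2 -
     (s' * f y' - c * s' + k * normv (s' *: y' - v) ^+ 2) =
     s * (f y - f y') + (s - s') * f y' - c * (s - s') +
     k * (normv (s *: y - v) ^+ 2 - normv (s' *: y' - v) ^+ 2) by ring.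
  have D0 : 0 <= D by apply: le_trans yy; apply: normv_ge0.
  have T1 : s * (f y - f y') <= S * L * D.
    apply: (@le_trans _ _ (s * (L * D))).
      rewrite ler_wpM2l//; first by lra.
      by apply: le_trans (fL _ _ yr y'r) _; rewrite ler_wpM2l.
    by rewrite -mulrA ler_wpM2r// mulr_ge0.
  have fy' : `|f y'| <= `|f v| + L * (2%:R * r).
    have h1 := fL _ _ y'r vr; have h2 := fL _ _ vr y'r.
    rewrite (normvBC v) in h2.
    have h3 : L * normv (y' - v) <= L * (2%:R * r).
      by rewrite ler_wpM2l//; have := normvB y' v; lra.
    have := ler_norm (f v); have := ler_norm (- f v); rewrite normrN ler_norml; lra.
  have T2 : (s - s') * f y' <= D * (`|f v| + L * (2%:R * r)).
    by apply: le_trans (ler_norm _) _; rewrite normrM ler_pM.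
  have T3 : - (c * (s - s')) <= `|c| * D.
    by apply: le_trans (ler_norm _) _; rewrite normrN normrM ler_wpM2l.
  have n1 : normv (s *: y - v) <= S * r + r.
    apply: le_trans (normvB _ _) (lerD _ vr).
    by rewrite normvZ_ge0 ?ler_pM ?normv_ge0//; lra.
  have n2 : normv (s' *: y' - v) <= S * r + r.
    apply: le_trans (normvB _ _) (lerD _ vr).
    by rewrite normvZ_ge0 ?ler_pM ?normv_ge0//; lra.
  have n3 : normv (s *: y - v) - normv (s' *: y' - v) <= (S + r) * D.
    rewrite lerBlDr; apply: le_trans (normv_triB _ (s' *: y' - v)) _.
    rewrite lerD2r.
    have -> : s *: y - v - (s' *: y' - v) = s *: (y - y') + (s - s') *: y'.
      by rewrite scalerBr scalerBl opprB addrA subrK addrA subrK.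
    apply: le_trans (normvD _ _) _; rewrite normvZ_ge0 ?normvZ; last by lra.
    by rewrite mulrDl (mulrC r) lerD// ler_pM ?normv_ge0//; lra.
  have T4 : normv (s *: y - v) ^+ 2 - normv (s' *: y' - v) ^+ 2 <=
     (S + r) * (2%:R * (S * r + r)) * D.
    rewrite subr_sqr mulrAC; apply: (@le_trans _ _ ((S + r) * D *
       (normv (s *: y - v) + normv (s' *: y' - v)))).
      by rewrite ler_wpM2r// addr_ge0 ?normv_ge0.
    by rewrite ler_wpM2l ?mulr_ge0 ?addr_ge0//; lra.
  have := ler_wpM2l k0 T4; rewrite (mulrA k).
  move: (k * ((S + r) * (2 * (S * r + r)))) => kk; lra.
have JK : exists2 z, K z & forall z', K z' -> J z <= J z'.
  apply: (argmin_compact (M := r + S) _ _ _ JL).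
  - exists (pairv v (const_mx 1)); rewrite /K row_mxKl row_mxKr mxE lexx S1.
    by [].
  - move=> z [yr /andP[s1 sS]]; rewrite -[z]hsubmxK.
    apply: le_trans (normv_pair_le _ _) (lerD yr _).
    apply: le_trans (normv_le_sum _) _; rewrite big_ord1 ger0_norm//; lra.
  - move=> u l uK ul; split.
      rewrite -[lsubmx l]subr0; apply/ler_addgt0Pr => e /ul[N /(_ N (leqnn _)) H].
      have [+ _] := subB l (u N); have [+ _] := uK N; rewrite (normvBC l) subr0.
      have := normv_triB (lsubmx l) (lsubmx (u N)); lra.
    apply/andP; split; apply/ler_addgt0Pr => e /ul[N /(_ N (leqnn _)) H].
      have [_ +] := subB (u N) l; have [_ /andP[+ _]] := uK N.
      rewrite ler_norml; lra.
    have [_ +] := subB (u N) l; have [_ /andP[_ +]] := uK N.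
    rewrite ler_norml; lra.
have [z [yr s1] zmin] := JK; exists (lsubmx z), (rsubmx z 0 0); split=> //.
move=> y' s' y'r s's.
have := zmin (pairv y' (const_mx s')); rewrite /J /K row_mxKl row_mxKr mxE.
by apply; split.
Qed.

End Semismooth.

(** * A mean value inequality along rays *)

Section Radial.
Context {R : realType}.

(* Minimise s f(y) - c s + k |s y - v|^2 over y and s in [1, S].  For k large
   the minimum is not at s = S; optimality in y then yields the subgradient
   p = -2k (s y - v) of f, and optimality in s yields <p, y> <= f y - c. *)
Lemma radial_mean_value n (f : 'rV[R]_n -> R) (L c : R) v S :
  0 <= L -> 0 < normv v ->
  (forall x y, normv x <= 2%:R * normv v -> normv y <= 2%:R * normv v ->
     f x - f y <= L * normv (x - y)) ->
  (forall y p C d, normv y < 2%:R * normv v -> 0 <= C -> 0 < d ->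
     (forall y', normv (y' - y) < d ->
        f y + dotv p (y' - y) - C * normv (y' - y) ^+ 2 <= f y') ->
     f y - c < dotv p y) ->
  1 <= S -> S * f (S^-1 *: v) - f v <= c * (S - 1).
Proof.
move=> L0 v0 fL fp S1; rewrite leNgt; apply/negP => gap.
set r := 2%:R * normv v in fL fp.
set g := S * f (S^-1 *: v) - f v - c * (S - 1).
have g0 : 0 < g by rewrite subr_gt0.
(* The first summand forces |s y - v| < |v| at the minimum, the second excludes s = S, the third
   makes k positive. *)
pose k := L / normv v + L ^+ 2 / g + 1.
have Lv0 : 0 <= L / normv v by rewrite divr_ge0// ltW.
have Lg0 : 0 <= L ^+ 2 / g by rewrite divr_ge0 ?sqr_ge0// ltW.
have k1 : 1 <= k by rewrite /k; lra.
have kv : L < k * normv v.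
  by rewrite -ltr_pdivrMr// /k; lra.
have kg : L ^+ 2 < k * g.
  by rewrite -ltr_pdivrMr// /k; lra.
have vr : normv v <= r by rewrite /r; lra.
have k0 : 0 < k by lra.
have [y [s [yr /andP[s1 sS] Jmin]]] := penalized_argmin c L0 (ltW k0) S1 vr fL.
have s0 : 0 < s by lra.
(* If s = S, comparison with (v, 1) and the Lipschitz bound give g <= L N - k N^2 <= L^2 / (4 k) for
   N = |S y - v|, against L^2 < k g. *)
have {}sS : s < S.
  rewrite lt_neqAle sS andbT; apply/eqP => sE.
  have := Jmin v 1 vr; rewrite lexx S1 => /(_ isT).
  rewrite scale1r subrr normv0 expr0n /= mulr0 addr0 mul1r mulr1 sE.
  have SV : normv (S^-1 *: v) <= r.
    rewrite normvZ_ge0 ?invr_ge0; last by lra.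
    by apply: le_trans vr; rewrite ler_piMl ?normv_ge0// invf_le1//; lra.
  have := fL _ _ SV yr.
  have -> : normv (S^-1 *: v - y) = S^-1 * normv (S *: y - v).
    rewrite normvBC -[RHS]normvZ_ge0 ?invr_ge0; last by lra.
    by rewrite scalerBr scalerA mulVf ?scale1r// gt_eqF//; lra.
  rewrite mulrCA ler_pdivlMl; last by lra.
  move: (normv (S *: y - v)) => N h1 h2; rewrite /g in g0 kg.
  have : 0 <= (2%:R * k * N - L) ^+ 2 by apply: sqr_ge0.
  nra.
(* Comparison with (v / s, s) gives k N^2 <= L N for N = |s y - v|. As s >= 1, this puts y in the
   interior of the ball of radius 2 |v|. *)
have yv : normv (s *: y - v) < normv v.
  have SV : normv (s^-1 *: v) <= r.
    rewrite normvZ_ge0 ?invr_ge0; last by lra.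
    by apply: le_trans vr; rewrite ler_piMl ?normv_ge0// invf_le1//; lra.
  have := Jmin _ s SV; rewrite s1 (ltW sS) => /(_ isT).
  rewrite scalerA divff ?gt_eqF// scale1r subrr normv0 expr0n/= mulr0 addr0.
  have := fL _ _ SV yr.
  have -> : normv (s^-1 *: v - y) = s^-1 * normv (s *: y - v).
    rewrite normvBC -[RHS]normvZ_ge0 ?invr_ge0; last by lra.
    by rewrite scalerBr scalerA mulVf ?scale1r// gt_eqF//; lra.
  rewrite mulrCA ler_pdivlMl//.
  have := normv_ge0 (s *: y - v).
  move: (normv (s *: y - v)) => N N0 h1 h2.
  rewrite ltNge; apply/negP => vN.
  have : L * N < k * normv v * N by rewrite ltr_pM2r//; lra.
  have := ler_wpM2l (ltW k0) (ler_wpM2r N0 vN); rewrite -mulrA -expr2; lra.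
have {}yr : normv y < r.
  apply: (@le_lt_trans _ _ (normv (s *: y))).
    by rewrite normvZ_ge0 ?ler_peMl ?normv_ge0//; lra.
  by have := normv_triB (s *: y) v; rewrite /r; lra.
pose p := (- 2%:R * k) *: (s *: y - v).
have kS : 0 <= k * S by rewrite mulr_ge0//; lra.
have fpy : f y - c < dotv p y.
  apply: (fp y p (k * S) (r - normv y)) => // [|y' y'y]; first by rewrite subr_gt0.
  have y'r : normv y' <= r by have := normv_triB y' y; lra.
  have := Jmin y' s y'r; rewrite s1 (ltW sS) => /(_ isT).
  have -> : normv (s *: y' - v) ^+ 2 = normv (s *: y - v) ^+ 2 +
      2%:R * s * dotv (s *: y - v) (y' - y) + s ^+ 2 * normv (y' - y) ^+ 2.
    rewrite !normv_sqr; have -> : s *: y' - v = (s *: y - v) + s *: (y' - y).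
      by rewrite scalerBr [RHS]addrC addrA subrK.
    by move: (s *: y - v) (y' - y) => a b; rewrite !dotvE (dotvC b); ring.
  rewrite /p dotvZl; move: (dotv (s *: y - v) _) => D.
  have := sqr_ge0 (normv (y' - y)).
  move: (normv (y' - y) ^+ 2) (normv (s *: y - v) ^+ 2) => N M N0 h.
  have h2 : s * (f y + - 2 * k * D - k * s * N) <= s * f y' by nra.
  rewrite ler_pM2l// in h2; have := ler_wpM2r N0 (ltW sS); nra.
(* Since s < S, competitors (y, s + h) with small h > 0 are admissible; in the limit they give <p,
   y> <= f y - c. The choice of [h] below makes the quadratic remainder at most e. *)
move: fpy; apply/negP; rewrite -leNgt -subr_ge0.
rewrite -oppr_le0; apply/ler_addgt0Pr => e e0; rewrite add0r.
pose h := Num.min (S - s) (e / (k * normv y ^+ 2 + 1)).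
have q0 : 0 < k * normv y ^+ 2 + 1 by rewrite ltr_wpDl// mulr_ge0 ?sqr_ge0//; lra.
have h0 : 0 < h by rewrite lt_min subr_gt0 sS divr_gt0.
have hs : h <= S - s by rewrite ge_min lexx.
have he : h * (k * normv y ^+ 2 + 1) <= e.
  by rewrite -ler_pdivlMr// ge_min lexx orbT.
have := Jmin y (s + h) (ltW yr); have -> : 1 <= s + h <= S by apply/andP; split; lra.
move=> /(_ isT).
have -> : normv ((s + h) *: y - v) ^+ 2 = normv (s *: y - v) ^+ 2 +
    2%:R * h * dotv (s *: y - v) y + h ^+ 2 * normv y ^+ 2.
  rewrite !normv_sqr; have -> : (s + h) *: y - v = (s *: y - v) + h *: y.
    by rewrite scalerDl addrAC.
  by move: (s *: y - v) => a; rewrite !dotvE (dotvC y); ring.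
rewrite /p dotvZl; move: (dotv (s *: y - v) _) => D.
move: (normv (s *: y - v) ^+ 2) (normv y ^+ 2) he => M N he H.
rewrite -(ler_pM2l h0); nra.
Qed.

End Radial.

(** * Radially homogeneous gradients *)

Section Potential.
Context {R : realType} {n : nat}.

(** Splitting a segment at its midpoint keeps the linear term and halves the quadratic constant, so
    repeated bisection removes the quadratic error. *)
Lemma lipschitz_of_quadratic_error (th : 'rV[R]_n -> R) (rho K C : R) : 0 <= C ->
  (forall x y, normv x <= rho -> normv y <= rho ->
     th x - th y <= K * normv (x - y) + C * normv (x - y) ^+ 2) ->
  forall x y, normv x <= rho -> normv y <= rho -> th x - th y <= K * normv (x - y).
Proof.
move=> C0 h.
have {}h N x y : normv x <= rho -> normv y <= rho ->
    th x - th y <= K * normv (x - y) + C / 2%:R ^+ N * normv (x - y) ^+ 2.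
  elim: N x y => [|N IH] x y xr yr; first by rewrite expr0 divr1; apply: h.
  pose z := 2%:R^-1 *: (x + y).
  have zr : normv z <= rho.
    rewrite normvZ_ge0 ?invr_ge0// ler_pdivrMl//.
    by apply: le_trans (normvD _ _) _; lra.
  have half : 2%:R^-1 *: (x + x) = x :> 'rV[R]_n.
    by rewrite -mulr2n -scaler_nat scalerA mulVf ?scale1r.
  have xz : normv (x - z) = 2%:R^-1 * normv (x - y).
    rewrite -[RHS]normvZ_ge0 ?invr_ge0// /z -{1}half -scalerBr.
    by congr (normv (_ *: _)); rewrite opprD addrACA subrr add0r.
  have zy : normv (z - y) = 2%:R^-1 * normv (x - y).
    rewrite -[RHS]normvZ_ge0 ?invr_ge0// /z.
    have {2}<- : 2%:R^-1 *: (y + y) = y :> 'rV[R]_n.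
      by rewrite -mulr2n -scaler_nat scalerA mulVf ?scale1r.
    rewrite -scalerBr.
    by congr (normv (_ *: _)); rewrite opprD addrACA subrr addr0.
  have := IH _ _ xr zr; have := IH _ _ zr yr; rewrite xz zy.
  have -> : C / 2%:R ^+ N = 2%:R * (C / 2%:R ^+ N.+1).
    by rewrite exprS invfM; move: (_ ^-1) => X; field.
  move: (C / _) (normv (x - y)) => c d; lra.
move=> x y xr yr; apply/ler_addgt0Pr => e e0.
have [|N /(_ N (leqnn _)) hN] := @invn_lt R (e / (C * normv (x - y) ^+ 2 + 1)).
  by rewrite divr_gt0// ltr_wpDl// mulr_ge0 ?sqr_ge0.
have q0 : 0 <= C * normv (x - y) ^+ 2 by rewrite mulr_ge0 ?sqr_ge0.
move: hN; rewrite ltr_pdivlMr ?ltr_wpDl// => hN.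
apply: le_trans (h N x y xr yr) _; rewrite lerD2l mulrAC.
have : (2%:R ^+ N)^-1 <= invn N :> R.
  by rewrite /invn lef_pV2 ?posrE ?exprn_gt0// -natrX ler_nat ltn_expl.
have := invn_gt0 N : 0 < _ :> R.
move: (_ ^-1) (invn N) hN q0 => a b; move: (C * _) => c; nra.
Qed.

Variables (m : 'rV[R]_n -> 'rV[R]_n) (g : 'rV[R]_n -> R) (kappa eta : R).
Hypotheses (kappa0 : 0 < kappa) (eta0 : 0 < eta) (m0 : m 0 = 0).
Hypothesis mL : forall v w, normv v < eta -> normv w < eta ->
  normv (m v - m w) <= kappa * normv (v - w).
Hypothesis gsub : forall v w, normv v < eta -> normv w < eta ->
  g v + dotv (m v) (w - v) <= g w.
(** Semismoothness in the form used here: (a, b) is a proximal normal to the set of points (m v, v),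
    and it is almost orthogonal to the position vector (m v, v). *)
Hypothesis normals : forall e : R, 0 < e -> exists2 del : R, 0 < del &
  forall v a b (C d : R), normv v < del -> 0 <= C -> 0 < d ->
    (forall v', normv (v' - v) < d ->
       dotv a (m v' - m v) + dotv b (v' - v) <= C * normv (v' - v) ^+ 2) ->
    `|dotv a (m v) + dotv b v| <= e * normv a * normv v.

(** The radial mean value inequality is applied to <a, m> where a is the defect itself, so that it
    bounds <a, a>. A proximal subgradient p of <a, m> at y yields the normal (- a, p); e / 3 leaves
    room for |y| < 2 |v|. *)
Lemma radial_homogeneity (e : R) : 0 < e -> exists2 del : R, 0 < del &
  forall v S, normv v < del -> 1 <= S ->
    normv (S *: m (S^-1 *: v) - m v) <= e * (S - 1) * normv v.
Proof.
move=> e0; have [|d d0 hd] := normals (e := e / 3%:R); first by lra.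
exists (Num.min d eta / 2%:R) => [|v S]; first by rewrite divr_gt0// lt_min d0.
rewrite ltr_pdivlMr// lt_min => /andP[vd veta] S1.
set a := _ - _.
have [v0|v0] := eqVneq v 0; first by rewrite /a v0 scaler0 m0 scaler0 subr0 normv0 mulr0.
have [->|a0] := eqVneq a 0.
  by rewrite normv0 !mulr_ge0 ?normv_ge0 ?(ltW e0)//; lra.
rewrite -!normv_gt0 in v0 a0.
have ev0 : 0 < e * normv a * normv v by rewrite !mulr_gt0.
have : S * dotv a (m (S^-1 *: v)) - dotv a (m v) <= (e * normv a * normv v) * (S - 1).
  apply: (radial_mean_value (f := fun y => dotv a (m y)) (L := kappa * normv a)) => //.
  - by rewrite mulr_ge0 ?normv_ge0 ?ltW.
  - move=> x y xv yv; rewrite -mulrA mulrCA -dotvNr -dotvDr.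
    apply: le_trans (dotv_le_norm _ _) _; rewrite ler_wpM2l ?normv_ge0// mL//; lra.
  - move=> y p C d' yv C0 d'0 hy.
    have yd : normv y < d by lra.
    have /(hd y (- a) p C d' yd C0 d'0) : forall v', normv (v' - y) < d' ->
        dotv (- a) (m v' - m y) + dotv p (v' - y) <= C * normv (v' - y) ^+ 2.
      by move=> v' v'y; have := hy v' v'y; rewrite !dotvE; lra.
    rewrite normvN ler_norml dotvNl => /andP[h _].
    have := yv; rewrite -(ltr_pM2l (mulr_gt0 e0 a0)) /=; lra.
rewrite -dotvZr -dotvNr -dotvDr -/a -normv_sqr => H; rewrite -(ler_pM2l a0); lra.
Qed.

(** The defect in Euler's identity: it vanishes when g is homogeneous of degree two with gradient
    m. *)
Let chi v := 2%:R * g v - dotv (m v) v.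

(* The gradient of v |-> S^2 g(v/S) - g v is S m(v/S) - m v, which is small by
   radial homogeneity; chi is the derivative of this function in S at S = 1. *)
Lemma chi_lipschitz (e : R) : 0 < e -> exists2 del : R, 0 < del & forall rho : R, rho < del ->
  forall x y, normv x <= rho -> normv y <= rho ->
    chi x - chi y <= e * rho * normv (x - y).
Proof.
move=> e0; have [d d0 hd] := radial_homogeneity e0.
exists (Num.min d eta) => [|rho]; first by rewrite lt_min d0.
rewrite lt_min => /andP[rd reta].
have divS (x : 'rV[R]_n) S : normv x <= rho -> 1 <= S -> normv (S^-1 *: x) < eta.
  move=> xr S1; rewrite normvZ_ge0 ?invr_ge0; last by lra.
  apply: le_lt_trans reta; apply: le_trans xr.
  by rewrite ler_piMl ?normv_ge0// invf_le1//; lra.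
pose th h x := (1 + h) ^+ 2 * g ((1 + h)^-1 *: x) - g x.
(* Subgradient inequalities at x / (1 + h) and at y bound the difference by the radial defect plus
   kappa |x - y|^2; bisection then discards the quadratic term. *)
have thL h : 0 < h -> forall x y, normv x <= rho -> normv y <= rho ->
    th h x - th h y <= e * h * rho * normv (x - y).
  move=> h0; apply: (lipschitz_of_quadratic_error (ltW kappa0)) => x y xr yr.
  have S1 : 1 <= 1 + h by lra.
  have S0 : 1 + h != 0 by rewrite gt_eqF//; lra.
  have g1 := gsub (divS x _ xr S1) (divS y _ yr S1).
  have g2 := gsub (le_lt_trans yr reta) (le_lt_trans xr reta).
  have mxy := mL (le_lt_trans xr reta) (le_lt_trans yr reta).
  have hx := hd x _ (le_lt_trans xr rd) S1.
  rewrite addrAC subrr add0r in hx.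
  have D1 := dotv_le_norm ((1 + h) *: m ((1 + h)^-1 *: x) - m x) (x - y).
  have D2 := dotv_le_norm (m x - m y) (x - y).
  have D1' : dotv ((1 + h) *: m ((1 + h)^-1 *: x) - m x) (x - y) <=
      e * h * rho * normv (x - y).
    apply: le_trans D1 _; rewrite ler_wpM2r ?normv_ge0//.
    by apply: le_trans hx _; rewrite ler_wpM2l// mulr_ge0// ltW.
  have D2' : dotv (m x - m y) (x - y) <= kappa * normv (x - y) ^+ 2.
    by apply: le_trans D2 _; rewrite expr2 mulrA ler_wpM2r ?normv_ge0.
  move: g1; rewrite -scalerBr dotvZr -(ler_pM2l (x := (1 + h) ^+ 2)) ?exprn_gt0//; last by lra.
  rewrite mulrDr expr2 -!mulrA mulVKf// => g1.
  move: D1' D2' g1 g2; rewrite /th !dotvE; lra.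
(* Up to order h^2, [th h x] is h times [chi x]; the lower bound uses the subgradient at x, the
   upper one the subgradient at x / (1 + h) and radial homogeneity. *)
have chi_th h x : 0 < h -> normv x <= rho ->
    h * (chi x + h * (g x - dotv (m x) x)) <= th h x /\
    th h x <= h * (chi x + h * (g x + e * normv x ^+ 2)).
  move=> h0 xr.
  have S1 : 1 <= 1 + h by lra.
  have S0 : 1 + h != 0 by rewrite gt_eqF//; lra.
  have g1 := gsub (divS x _ xr S1) (le_lt_trans xr reta).
  have g2 := gsub (le_lt_trans xr reta) (divS x _ xr S1).
  have hx := hd x _ (le_lt_trans xr rd) S1.
  rewrite addrAC subrr add0r in hx.
  have D1 := normr_dotv ((1 + h) *: m ((1 + h)^-1 *: x) - m x) x.
  have {hx} D1 := le_trans D1 (ler_wpM2r (normv_ge0 x) hx).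
  move: D1; rewrite ler_norml => /andP[D1 _].
  have SS : (1 + h)^-1 *: x - x = - (h / (1 + h)) *: x.
    rewrite -{2}[x]scale1r -scalerBl; congr (_ *: _); field; lra.
  rewrite -opprB SS in g1; rewrite SS in g2.
  have E2 : 0 < (1 + h) ^+ 2 by rewrite exprn_gt0//; lra.
  rewrite -(ler_pM2l E2) in g1; rewrite -(ler_pM2l E2) in g2.
  move: D1 g1 g2; rewrite /th /chi scaleNr opprK !dotvE.
  move: (g x) (dotv (m x) x) (g _) (dotv (m (_ *: x)) x) (normv x) => a b c d' N.
  have -> : (1 + h) ^+ 2 * (c + h / (1 + h) * d') = (1 + h) ^+ 2 * c + h * ((1 + h) * d').
    by field; lra.
  have -> : (1 + h) ^+ 2 * (a - h / (1 + h) * b) = (1 + h) ^+ 2 * a - h * ((1 + h) * b).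
    by field; lra.
  move=> D1 g1 g2; split; first by move: g2; move: ((1 + h) ^+ 2 * c) => C; nra.
  have := ler_wpM2l (ltW h0) D1; move: g1; move: ((1 + h) ^+ 2 * c) => C; nra.
move=> x y xr yr; apply/ler_addgt0Pr => eps eps0.
(* [B] collects the second-order terms of both bounds; [h] is chosen so that they contribute at most
   eps after division by h. *)
pose B := g y + e * normv y ^+ 2 - (g x - dotv (m x) x).
pose h := eps / (`|B| + 1).
have h0 : 0 < h by rewrite divr_gt0// ltr_wpDl.
have hB : h * B <= eps.
  have : h * (`|B| + 1) = eps by rewrite divfK// gt_eqF// ltr_wpDl.
  have := ler_norm B; nra.
have [cx _] := chi_th h x h0 xr; have [_ cy] := chi_th h y h0 yr.
have := thL h h0 x y xr yr; have := ler_wpM2l (ltW h0) hB; move: cx cy.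
rewrite /B => cx cy H1 H2; rewrite -(ler_pM2l h0); lra.
Qed.

(* An approximate symmetry of the derivative of m, which is a gradient: if m
   were differentiable at v this would say that (Dm v)^T v is close to
   m v, while radial homogeneity says that (Dm v) v is close to m v. *)
Lemma approx_symmetry (e : R) : 0 < e -> exists2 del : R, 0 < del & forall v v',
  normv v < del -> normv v' < del ->
  dotv (m v' - m v) v <= dotv (m v) (v' - v) +
    (e * normv v + (e + kappa) * normv (v' - v)) * normv (v' - v).
Proof.
move=> e0; have [d d0 hd] := chi_lipschitz e0.
exists (Num.min d eta) => [|v v']; first by rewrite lt_min d0.
rewrite !lt_min => /andP[vd veta] /andP[v'd v'eta].
have [rho [rd vr v'r rle]] : exists rho, [/\ rho < d, normv v <= rho, normv v' <= rho &
    rho <= normv v + normv (v' - v)].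
  exists (Num.max (normv v) (normv v')); rewrite gt_max vd v'd !le_max !lexx orbT.
  by split=> //; rewrite ge_max lerDl normv_ge0 /=; have := normv_triB v' v; lra.
have := hd rho rd v v' vr v'r; rewrite (normvBC v).
have g1 := gsub v'eta veta.
have mv := mL v'eta veta.
have D := dotv_le_norm (m v' - m v) (v' - v).
have {mv}D := le_trans D (ler_wpM2r (normv_ge0 _) mv).
have {rle}E := ler_wpM2l (ltW e0) rle.
have {E}E := ler_wpM2r (normv_ge0 (v' - v)) E.
move: g1 D E; rewrite /chi !dotvE; lra.
Qed.

(** The normal inequality is tested along u = q - (m v + r v). Replacing p by - v costs the term
    with |p + v|, and approximate symmetry then bounds <v, m v' - m v> from above by almost <m v, v'
    - v>. The slack in p serves limiting normals. *)
Lemma normal_estimate (r e : R) : 0 <= r -> 0 < e -> exists2 del : R, 0 < del & forall v p q,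
  normv v < del ->
  (forall e0 : R, 0 < e0 -> exists2 d : R, 0 < d & forall v', v' != v -> normv (v' - v) < d ->
     dotv p (m v' + r *: v' - (m v + r *: v)) + dotv q (v' - v) <= e0 * normv (v' - v)) ->
  normv (q - (m v + r *: v)) <= e * normv v + (kappa + r) * normv (p + v).
Proof.
have kp := kappa0; move=> r0 e0; have [d d0 hd] := approx_symmetry e0.
exists (Num.min d eta) => [|v p q]; first by rewrite lt_min d0.
rewrite lt_min => /andP[vd veta] hN.
have nn : 0 <= e * normv v + (kappa + r) * normv (p + v).
  by apply: addr_ge0; apply: mulr_ge0;
    rewrite ?normv_ge0 ?(ltW e0) ?addr_ge0 ?(ltW kappa0).
set u := q - _; have [->|u0] := eqVneq u 0; first by rewrite normv0.
rewrite -normv_gt0 in u0; apply: normv_le_of_small => // eps eps0.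
have [|d' d'0 hd'] := hN (eps / 2%:R); first by lra.
have ed : 0 < e + kappa by lra.
(* Steps shorter than [T] stay in both domains and within the radius of the normal inequality, and
   (e + kappa) |v' - v| stays below eps / 2. *)
pose T := Num.min (Num.min (d - normv v) (eta - normv v))
                  (Num.min d' (eps / 2%:R / (e + kappa))).
have T0 : 0 < T by rewrite !lt_min !subr_gt0 vd veta d'0 !divr_gt0.
pose t := T / 2%:R / normv u.
have t0 : 0 < t by rewrite !divr_gt0.
have tT : normv (t *: u) < T.
  by rewrite normvZ_ge0 ?(ltW t0)// divfK ?gt_eqF//; lra.
exists t; split=> //.
have tn0 : 0 < normv (t *: u) by rewrite normvZ_ge0 ?(ltW t0)// mulr_gt0.
pose v' := v + t *: u; have v'v : v' - v = t *: u by rewrite addrC addKr.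
move: tT; rewrite !lt_min => /andP[/andP[td teta] /andP[td' te]].
have v'n := normv_triB v' v; rewrite v'v in v'n.
have v'd : normv v' < d by lra.
have v'eta : normv v' < eta by lra.
have S := hd v v' vd v'd.
have mv := mL v'eta veta.
have vv : v' != v by rewrite -subr_eq0 v'v -normv_gt0.
have N := hd' v' vv; rewrite v'v in N; have {}N := N td'.
rewrite v'v in S mv.
have P := normr_dotv (p + v) (m v' + r *: v' - (m v + r *: v)).
have E : m v' + r *: v' - (m v + r *: v) = (m v' - m v) + r *: (t *: u).
  by rewrite -v'v scalerBr opprD addrACA.
rewrite E in P N.
have L : normv (m v' - m v + r *: (t *: u)) <= (kappa + r) * normv (t *: u).
  by apply: le_trans (normvD _ _) _; rewrite (normvZ_ge0 _ r0) mulrDl lerD2r.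
have {}P := le_trans P (ler_wpM2l (normv_ge0 _) L).
move: te; rewrite ltr_pdivlMr// => te.
have {}te := ler_wpM2r (ltW tn0) (ltW te).
move: P; rewrite ler_norml => /andP[P _].
have -> : dotv u (t *: u) = dotv q (t *: u) - dotv (m v) (t *: u) - r * dotv v (t *: u).
  by rewrite {1}/u !dotvE; ring.
move: (t *: u) (normv (t *: u)) te P S N => w W te P S N.
move: (m v' - m v) P S N => z P S N.
move: P S N; rewrite !dotvE (dotvC v z) => P S N; lra.
Qed.

(** As q' is close to - v, the point v + t q' is close to (1 - t) v, where m is nearly (1 - t) m v
    by radial homogeneity with S = 1 / (1 - t). Hence d' is close to - (m v + r v). *)
Lemma tangent_estimate (r e : R) : 0 <= r -> 0 < e -> exists2 del : R, 0 < del & forall v d,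
  normv v < del ->
  (forall e0 : R, 0 < e0 -> exists (t : R) (d' q' : 'rV[R]_n), [/\ 0 < t < 1, normv (d' - d) <= e0,
     normv (q' + v) <= e0, normv (v + t *: q') < eta &
     m (v + t *: q') + r *: (v + t *: q') = m v + r *: v + t *: d']) ->
  normv (d + (m v + r *: v)) <= e * normv v.
Proof.
have kp := kappa0; move=> r0 e0; have [del d0 hd] := radial_homogeneity e0.
exists (Num.min del eta) => [|v d]; first by rewrite lt_min d0.
rewrite lt_min => /andP[vd veta] hT; apply/ler_addgt0Pr => eps eps0.
have K0 : 0 < 1 + kappa + r by lra.
have [|t [d' [q' [/andP[t0 t1] d'd q'v v'eta E]]]] := hT (eps / (1 + kappa + r)).
  by rewrite divr_gt0.
move: d'd q'v; rewrite !ler_pdivlMr// => d'd q'v.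
pose w := (1 - t) *: v.
have wv : normv w <= normv v by rewrite normvZ_ge0 ?ler_piMl ?normv_ge0//; lra.
have H : normv (m w - (1 - t) *: m v) <= t * (e * normv v).
  have S1 : 1 <= (1 - t)^-1 by rewrite invf_ge1; lra.
  have := hd v _ vd S1; rewrite invrK -/w.
  have -> : (1 - t)^-1 *: m w - m v = (1 - t)^-1 *: (m w - (1 - t) *: m v).
    by rewrite scalerBr scalerA mulVf ?scale1r// gt_eqF//; lra.
  rewrite normvZ_ge0; last by lra.
  rewrite ler_pdivrMl; last by lra.
  move/le_trans; apply; rewrite le_eqVlt; apply/orP; left; apply/eqP; field; lra.
have M := mL v'eta (le_lt_trans wv veta).
have vw : v + t *: q' - w = t *: (q' + v).
  by apply/rowP => i; rewrite !mxE; ring.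
rewrite vw (normvZ_ge0 _ (ltW t0)) in M.
have X : t *: (d + (m v + r *: v)) = (m (v + t *: q') - m w) + (m w - (1 - t) *: m v)
    + r *: (t *: (q' + v)) - t *: (d' - d).
  apply/rowP => i; have /rowP/(_ i) := E; rewrite !mxE /w; lra.
rewrite -(ler_pM2l t0) -(normvZ_ge0 _ (ltW t0)) X.
apply: le_trans (normvB _ _) _; rewrite (normvZ_ge0 _ (ltW t0)).
have := normvD (m (v + t *: q') - m w + (m w - (1 - t) *: m v)) (r *: (t *: (q' + v))).
have := normvD (m (v + t *: q') - m w) (m w - (1 - t) *: m v).
rewrite (normvZ_ge0 _ r0) (normvZ_ge0 _ (ltW t0)).
have := ler_wpM2l (ltW t0) d'd; have := ler_wpM2l (ltW t0) q'v.
have := normv_ge0 (q' + v); have := normv_ge0 (d' - d).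
move: (normv (q' + v)) (normv (d' - d)) M => Q D M Q0 D0.
nra.
Qed.

End Potential.

(** * Inversion of v |-> m v + r v *)

Section Resolvent.
Context {R : realType} {n : nat}.
Variables (m : 'rV[R]_n -> 'rV[R]_n) (g : 'rV[R]_n -> R) (kappa eta r : R).
Hypotheses (kappa0 : 0 < kappa) (eta0 : 0 < eta) (r0 : 0 < r) (m0 : m 0 = 0).
Hypothesis mL : forall v w, normv v < eta -> normv w < eta ->
  normv (m v - m w) <= kappa * normv (v - w).
Hypothesis gsub : forall v w, normv v < eta -> normv w < eta ->
  g v + dotv (m v) (w - v) <= g w.

Definition shift_map v := m v + r *: v.

Lemma shift_mapB v w : shift_map v - shift_map w = (m v - m w) + r *: (v - w).
Proof. by rewrite /shift_map scalerBr opprD addrACA. Qed.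

Lemma shift_map_lipschitz v w : normv v < eta -> normv w < eta ->
  normv (shift_map v - shift_map w) <= (kappa + r) * normv (v - w).
Proof.
move=> ve we; rewrite shift_mapB; apply: le_trans (normvD _ _) _.
by rewrite (normvZ_ge0 _ (ltW r0)) mulrDl lerD2r mL.
Qed.

(** Adding the two subgradient inequalities shows that m is monotone, so the shift by r v makes the
    map strongly monotone with constant r. *)
Lemma shift_map_expansive v w : normv v < eta -> normv w < eta ->
  r * normv (v - w) <= normv (shift_map v - shift_map w).
Proof.
move=> ve we; have [->|] := eqVneq (v - w) 0; first by rewrite normv0 mulr0 normv_ge0.
rewrite -normv_gt0 => vw0; rewrite -(ler_pM2r vw0).
apply: le_trans (dotv_le_norm _ _); rewrite shift_mapB -mulrA -expr2 normv_sqr.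
rewrite [leRHS]dotvDl dotvZl lerDr.
have := gsub ve we; have := gsub we ve; rewrite !dotvE; lra.
Qed.

Lemma shift_map_le v : normv v < eta -> r * normv v <= normv (shift_map v).
Proof.
move=> ve; have := @shift_map_expansive v 0 ve.
by rewrite normv0 /shift_map m0 scaler0 add0r !subr0; apply.
Qed.

(* Minimise g + r/2 |.|^2 - <z, .>. *)
Lemma shift_map_surjective z : normv z < r * eta / 4%:R ->
  exists2 v, normv v < eta & shift_map v = z.
Proof.
have kp := kappa0; have rp := r0; have ep := eta0.
move=> zr; pose F v := g v + r / 2%:R * normv v ^+ 2 - dotv z v.
have zr4 : 2%:R * normv z < r * (eta / 2%:R) by lra.
have FL x y : normv (x - 0) <= eta / 2%:R -> normv (y - 0) <= eta / 2%:R ->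
    F x - F y <= (kappa * eta + r * eta + normv z) * normv (x - y).
  rewrite !subr0 => xe ye.
  have xe' : normv x < eta by lra.
  have ye' : normv y < eta by lra.
  have z0' : normv (0 : 'rV[R]_n) < eta by rewrite normv0.
  have mx : normv (m x) <= kappa * eta.
    have := mL xe' z0'; rewrite m0 !subr0 => /le_trans; apply.
    by rewrite ler_wpM2l ?ltW.
  have A1 := le_trans (dotv_le_norm (m x) (x - y)) (ler_wpM2r (normv_ge0 _) mx).
  have A2 := dotv_le_norm (x + y) (x - y).
  have A3 : normv (x + y) <= eta by apply: le_trans (normvD _ _) _; lra.
  have {A3}A2 := le_trans A2 (ler_wpM2r (normv_ge0 _) A3).
  have A4 := normr_dotv z (x - y); move: A4; rewrite ler_norml => /andP[A4 _].
  have {}A2 := ler_wpM2l (ltW rp) A2.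
  have rN : 0 <= r * eta * normv (x - y) by rewrite !mulr_ge0 ?normv_ge0// ltW.
  have := gsub xe' ye'; move: A1 A2 A4; rewrite /F !normv_sqr !dotvE (dotvC y x).
  lra.
have [|v] := argmin_ball _ FL; first by lra.
rewrite subr0 => vr vmin; exists v; first by lra.
have ve : normv v < eta by lra.
(* Comparison with 0, where g is minimal because m 0 = 0, gives r |v|^2 <= 2 |z| |v|; the minimiser
   is therefore interior. *)
have vr' : normv v < eta / 2%:R.
  have z0' : normv (0 : 'rV[R]_n) < eta by rewrite normv0.
  have e2 : 0 <= eta / 2%:R by lra.
  have := vmin 0; rewrite subrr normv0 => /(_ e2).
  rewrite /F normv0 dotv0 expr0n /= mulr0 !addr0 subr0 => H.
  have := gsub z0' ve; rewrite m0 dot0v addr0 => H'.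
  have H2 := dotv_le_norm z v.
  have vn0 := normv_ge0 v.
  rewrite ltNge; apply/negP => vge.
  have : r * (eta / 2%:R) * normv v <= r * normv v ^+ 2.
    by rewrite -mulrA expr2 ler_wpM2l ?(ltW rp)// ler_wpM2r.
  have : 2%:R * normv z * normv v < r * (eta / 2%:R) * normv v by rewrite ltr_pM2r//; lra.
  lra.
apply/eqP; rewrite -subr_eq0; apply/negPn/negP; rewrite -normv_gt0.
set u := _ - z => u0.
(* A nonzero residual u would allow a descent step: v - t u stays in the ball, and t (kappa + r) <=
   1/2 lets the decrease t |u|^2 outweigh the second-order terms. *)
pose t := Num.min ((eta / 2%:R - normv v) / normv u) (1 / (2%:R * (kappa + r))).
have t0 : 0 < t.
  by rewrite lt_min !divr_gt0 ?subr_gt0 ?mulr_gt0 ?addr_gt0.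
have tu : t * normv u <= eta / 2%:R - normv v by rewrite -ler_pdivlMr// ge_min lexx.
have tk : t * (2%:R * (kappa + r)) <= 1.
  by rewrite -ler_pdivlMr ?ge_min ?lexx ?orbT// mulr_gt0 ?addr_gt0.
pose v' := v - t *: u.
have vv' : v' - v = - (t *: u) by rewrite addrC addKr.
have v'r : normv v' <= eta / 2%:R.
  apply: le_trans (normvB _ _) _; rewrite (normvZ_ge0 _ (ltW t0)); lra.
have v'e : normv v' < eta by lra.
have := vmin v'; rewrite subr0 => /(_ v'r).
have := gsub v'e ve; rewrite -opprB vv' opprK.
have := mL v'e ve; rewrite vv' normvN (normvZ_ge0 _ (ltW t0)) => M.
have := le_trans (normr_dotv (m v' - m v) u) (ler_wpM2r (ltW u0) M).
rewrite ler_norml => /andP[D _].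
have {}D := ler_wpM2l (ltW t0) D.
have E : normv u ^+ 2 = dotv (m v) u + r * dotv v u - dotv z u.
  by rewrite normv_sqr {1}/u /shift_map !dotvE.
have tu2 : 0 < t * normv u ^+ 2 by rewrite mulr_gt0// exprn_gt0.
have {}tk := ler_wpM2r (ltW tu2) tk.
have tr : 0 < t * r * (t * normv u ^+ 2) by rewrite !mulr_gt0.
have nv' (a b : 'rV[R]_n) :
    normv (a - t *: b) ^+ 2 = normv a ^+ 2 - 2%:R * t * dotv a b + t ^+ 2 * normv b ^+ 2.
  by rewrite !normv_sqr !dotvE (dotvC b a); ring.
clearbody u; rewrite /F nv' dotvDr dotvNr dotvZr.
have ez : dotv (m v') u = dotv (m v' - m v) u + dotv (m v) u by rewrite !dotvE; ring.
rewrite dotvZr ez.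
have D0 : t * dotv (m v' - m v) u >= - (t * (kappa * (t * normv u) * normv u)) by lra.
move: (dotv (m v' - m v) u) D0 => D' D0.
move: (normv u) E tk tr tu2 D0 {vv' v'r v'e M D tu u0 ez} => N E tk tr tu2 D0 H1 H2.
have tE : t * N ^+ 2 = t * (dotv (m v) u + r * dotv v u - dotv z u) by rewrite E.
lra.
Qed.

End Resolvent.

(** * Newton steps on a Lipschitz graph *)

Section NewtonSteps.
Context {R : realType} {n : nat}.
Variables (P : 'rV[R]_n -> 'rV[R]_n) (L eta r del0 : R) (xb : 'rV[R]_n).
Variable G : 'rV[R]_n -> 'rV[R]_n -> Prop.
Hypotheses (L0 : 0 < L) (r0 : 0 < r) (del00 : 0 < del0).
Hypothesis PL : forall v w, normv v < eta -> normv w < eta ->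
  normv (P v - P w) <= L * normv (v - w).
Hypothesis Ple : forall v, normv v < eta -> r * normv v <= normv (P v).
(** In the application [G] is the gradient of the envelope and [P v] is m v + r v: the graph is
    parametrised by the gradient value v. *)
Hypothesis GP : forall x v, normv (x - xb) < del0 ->
  (G x v <-> normv v < eta /\ x = xb + P v).

Lemma addBl (a b c : 'rV[R]_n) : c + a - (c + b) = a - b.
Proof. by rewrite opprD addrACA subrr add0r. Qed.

Lemma gph_pair (F : 'rV[R]_n -> 'rV[R]_n -> Prop) x y : gph F (pairv x y) <-> F x y.
Proof.
split=> [[x' [y' [+ Fxy]]]|Fxy]; last by exists x, y.
by move=> /eq_row_mx[-> ->].
Qed.

Lemma graph_val_le x v : normv (x - xb) < del0 -> G x v -> r * normv v <= normv (x - xb).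
Proof.
by move=> xd /(GP _ xd)[ve ->]; rewrite addrC addKr Ple.
Qed.

Lemma gph_near x v t : normv (x - xb) < del0 -> G x v -> normv t < eta ->
  L * normv (t - v) < del0 - normv (x - xb) -> G (xb + P t) t.
Proof.
move=> xd /(GP _ xd)[ve xE] te tv; apply/GP => //; rewrite addrC addKr.
have xP : x - xb = P v by rewrite xE addrC addKr.
have := PL te ve; have := normv_triB (P t) (P v); move: tv; rewrite xP; lra.
Qed.

Hypothesis normal_est : forall e : R, 0 < e -> exists2 del : R, 0 < del &
  forall v p q, normv v < del ->
  (forall e0 : R, 0 < e0 -> exists2 d : R, 0 < d & forall v', v' != v ->
     normv (v' - v) < d ->
     dotv p (P v' - P v) + dotv q (v' - v) <= e0 * normv (v' - v)) ->
  normv (q - P v) <= e * normv v + L * normv (p + v).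

(** A limiting normal is approximated by a regular normal (p, q) at a nearby graph point (x', v'),
    with p close to - v and q close to d. The estimate there says that q is close to P v' = x' -
    xb. *)
Lemma coderivative_step_estimate (e : R) : 0 < e -> exists2 del : R, 0 < del &
  forall x v d, normv (x - xb) < del -> G x v -> coderiv G x v (- d) (- v) ->
  normv (x - d - xb) <= e * normv (x - xb).
Proof.
have Lp := L0; have rp := r0.
move=> e0; have [|del d0 hd] := normal_est (e := e * r); first by rewrite mulr_gt0.
exists (Num.min del0 (r * del)) => [|x v d].
  by rewrite lt_min del00 mulr_gt0.
rewrite lt_min => /andP[xd0 xd] Gxv [zk [wk [zG [zx [wv wN]]]]].
have vx := ler_wpM2l (ltW e0) (graph_val_le xd0 Gxv).
suff : normv (x - d - xb) <= e * r * normv v by lra.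
apply/ler_addgt0Pr => eps eps0.
have M0 : 0 < 2%:R + e * r + 2%:R * L.
  by have := mulr_gt0 e0 rp; lra.
(* The divisor counts the approximation errors: |x - x'| and |d - q|, the shift of |v'| weighted by
   e r, and |p + v'| <= 2 a weighted by L. *)
pose a := Num.min (eps / (2%:R + e * r + 2%:R * L))
  (Num.min (del0 - normv (x - xb)) (r * del - normv (x - xb))).
have a0 : 0 < a by rewrite !lt_min divr_gt0// !subr_gt0 xd0 xd.
have aE : a * (2%:R + e * r + 2%:R * L) <= eps by rewrite -ler_pdivlMr// ge_min lexx.
have [ad0 ad] : a <= del0 - normv (x - xb) /\ a <= r * del - normv (x - xb).
  by rewrite !ge_min !lexx !orbT.
have [N1 h1] := zx a a0; have [N2 h2] := wv a a0.
have k1 := leq_maxl N1 N2; have k2 := leq_maxr N1 N2.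
move: (maxn N1 N2) k1 k2 => k /h1 + /h2 + {h1 h2 zx wv}.
have [x' [v' [zE G']]] := zG k.
have := wN k; rewrite zE -[wk k]hsubmxK -/(pairv _ _).
move: (lsubmx (wk k)) (rsubmx (wk k)) => p q {zE zG wN zk wk N1 N2 k}.
rewrite !pairvB !opprK => pqN xx' pq.
have xx := le_lt_trans (normv_pairl _ _) xx'.
have vv := le_lt_trans (normv_pairr _ _) xx'.
have pv := le_lt_trans (normv_pairl _ _) pq.
have qd := le_lt_trans (normv_pairr _ _) pq.
have x'x := normv_tri x' x xb.
have x'd0 : normv (x' - xb) < del0 by lra.
have := graph_val_le x'd0 G' => v'x.
have v'd : normv v' < del by rewrite -(ltr_pM2l r0); lra.
have [v'e x'E] := iffLR (GP _ x'd0) G'.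
have E : x - d - xb = (x - x') - (d - q) - (q - P v').
  by rewrite x'E; apply/rowP => i; rewrite !mxE; ring.
rewrite E.
have B : normv (q - P v') <= e * r * normv v' + L * normv (p + v').
  apply: hd => // e' e'0.
  have [_ /(_ (e' / (L + 1)))[|d' [d'0 hN]]] := pqN; first by rewrite divr_gt0//; lra.
  (* Keeps (xb + P w, w) on the graph and within d' of the base point; graph distances are at most
     (L + 1) |w - v'|. *)
  pose s := Num.min (eta - normv v') (Num.min ((del0 - normv (x' - xb)) / L) (d' / (L + 1))).
  exists s => [|w wv' ws].
    by rewrite !lt_min subr_gt0 v'e !divr_gt0 ?subr_gt0//; lra.
  move: ws; rewrite !lt_min !ltr_pdivlMr//; last by lra.
  move=> /and3P[we wd wd'].
  have wtri := normv_triB w v'.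
  have we' : normv w < eta by lra.
  have Gw : G (xb + P w) w by apply: gph_near x'd0 G' we' _; lra.
  have := hN _ (iffRL (gph_pair G _ _) Gw).
  rewrite pairvB dotv_pair x'E addBl.
  have PP : normv (pairv (P w - P v') (w - v')) <= (L + 1) * normv (w - v').
    apply: le_trans (normv_pair_le _ _) _.
    by rewrite mulrDl mul1r lerD2r PL.
  move=> H1; apply: le_trans (H1 _ _) _.
  - by apply: contraNneq wv' => /eq_row_mx[_ ->].
  - by apply: le_lt_trans PP _; rewrite mulrC.
  - rewrite -mulrA ler_wpM2l ?(ltW e'0)// ler_pdivrMl//; lra.
have T1 := normvB (x - x' - (d - q)) (q - P v').
have T2 := normvB (x - x') (d - q).
have T3 : normv (p + v') <= 2%:R * a.
  have -> : p + v' = (p - - v) + (v' - v) by rewrite opprK addrACA subrr addr0.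
  by apply: le_trans (normvD _ _) _; rewrite opprK; lra.
have T4 := normv_triB v' v.
rewrite (normvBC x) (normvBC d) in T2.
have {}T3 := ler_wpM2l (ltW L0) T3.
have T5 : e * r * normv v' <= e * r * (normv v + a).
  by rewrite ler_wpM2l ?mulr_ge0 ?ltW//; lra.
lra.
Qed.

Hypothesis tangent_est : forall e : R, 0 < e -> exists2 del : R, 0 < del &
  forall v d, normv v < del ->
  (forall e0 : R, 0 < e0 -> exists (t : R) (d' q' : 'rV[R]_n), [/\ 0 < t < 1,
     normv (d' - d) <= e0, normv (q' + v) <= e0, normv (v + t *: q') < eta &
     P (v + t *: q') = P v + t *: d']) ->
  normv (d + P v) <= e * normv v.

(** Since x = xb + P v, the new error is d + P v, and late terms of the tangent sequence supply the
    data of the tangent estimate. *)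
Lemma graphical_step_estimate (e : R) : 0 < e -> exists2 del : R, 0 < del &
  forall x v d, normv (x - xb) < del -> G x v -> graphD G x v d (- v) ->
  normv (x + d - xb) <= e * normv (x - xb).
Proof.
have rp := r0.
move=> e0; have [|del d0 hd] := tangent_est (e := e * r); first by rewrite mulr_gt0.
exists (Num.min del0 (r * del)) => [|x v d].
  by rewrite lt_min del00 mulr_gt0.
rewrite lt_min => /andP[xd0 xd] Gxv [t [wk [[t0 tcv] [wcv wG]]]].
have vx := graph_val_le xd0 Gxv.
have [ve xE] := iffLR (GP _ xd0) Gxv.
have vd : normv v < del by rewrite -(ltr_pM2l r0); lra.
have -> : x + d - xb = d + P v by rewrite xE addrAC [xb + _]addrC addrK addrC.
have := ler_wpM2l (ltW e0) vx.
suff : normv (d + P v) <= e * r * normv v by lra.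
apply: hd => // e' e'0.
have M0 : 0 < normv d + e' + 1 by have := normv_ge0 d; lra.
have [|N1 h1] := tcv (Num.min 1 ((del0 - normv (x - xb)) / (normv d + e' + 1))).
  by rewrite lt_min ltr01 divr_gt0// subr_gt0.
have [N2 h2] := wcv e' e'0.
have k1 := leq_maxl N1 N2; have k2 := leq_maxr N1 N2.
move: (maxn N1 N2) k1 k2 => k /h1 + /h2 + {h1 h2 tcv wcv}.
have := wG k; rewrite -[wk k]hsubmxK -/(pairv _ _) pairvB.
move: (t k) (t0 k) (lsubmx (wk k)) (rsubmx (wk k)) => {t0 wG}t t0 d' q' {wk N1 N2 k}.
rewrite subr0 gtr0_norm// lt_min => + /andP[t1 td] dq.
have d'd := le_lt_trans (normv_pairl _ _) dq.
have q'v := le_lt_trans (normv_pairr _ _) dq; rewrite opprK in q'v.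
rewrite pairvDZ => /gph_pair G'.
have x'd : normv (x + t *: d' - xb) < del0.
  rewrite addrAC; apply: le_lt_trans (normvD _ _) _; rewrite (normvZ_ge0 _ (ltW t0)).
  move: td; rewrite ltr_pdivlMr// => td.
  have := normv_triB d' d => T.
  have : t * normv d' <= t * (normv d + e' + 1) by rewrite ler_wpM2l ?(ltW t0)//; lra.
  lra.
have [v'e x'E] := iffLR (GP _ x'd) G'.
exists t, d', q'; split; rewrite ?(ltW d'd) ?(ltW q'v) ?t0//.
by apply: (addrI xb); rewrite addrA -xE -x'E.
Qed.

(** Minimising <v, P w> + K |w - v|^2 near v with K growing gives regular normals (- v, 2 K (v - w))
    at graph points tending to (x, v). They stay bounded because P is Lipschitz, and a cluster point
    provides d. *)
Lemma coderivative_step_exists x v : normv (x - xb) < del0 -> G x v ->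
  exists d, coderiv G x v (- d) (- v).
Proof.
have Lp := L0; move=> xd Gxv; have [ve xE] := iffLR (GP _ xd) Gxv.
pose rad := Num.min ((eta - normv v) / 2%:R) ((del0 - normv (x - xb)) / (2%:R * L)).
have rad0 : 0 < rad by rewrite lt_min !divr_gt0 ?subr_gt0 ?mulr_gt0.
have rade : normv v + rad < eta.
  have : rad <= (eta - normv v) / 2%:R by rewrite ge_min lexx.
  lra.
have radd : L * rad < del0 - normv (x - xb).
  have : rad <= (del0 - normv (x - xb)) / (2%:R * L) by rewrite ge_min lexx orbT.
  rewrite ler_pdivlMr ?mulr_gt0//; move: xd; rewrite -subr_gt0; lra.
pose f w := dotv v (P w).
pose C := normv v * L.
have C0 : 0 <= C by rewrite mulr_ge0 ?normv_ge0// ltW.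
have inb w : normv (w - v) <= rad -> normv w < eta.
  by have := normv_triB w v; lra.
have fC a b : normv (a - v) <= rad -> normv (b - v) <= rad -> f a - f b <= C * normv (a - b).
  move=> /inb ae /inb be; rewrite /f -dotvNr -dotvDr.
  apply: le_trans (dotv_le_norm _ _) _.
  by rewrite /C -mulrA ler_wpM2l ?normv_ge0// PL.
have /choice[vb hvb] : forall k : nat, exists vb : 'rV[R]_n * 'rV[R]_n,
    [/\ normv (vb.1 - v) <= rad * invn k, normv vb.2 <= 2%:R * C &
     Nhat (gph G) (pairv (xb + P vb.1) vb.1) (pairv (- v) vb.2)].
  (* Minimality yields K |w - v| <= C, so this K places w within rad / (k + 1) of v, strictly inside
     the ball. *)
  move=> k; pose K := (C + 1) / rad * k.+1%:R.
  have K0 : 0 < K by rewrite mulr_gt0// divr_gt0//; lra.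
  have KE : K * (rad * invn k) = C + 1.
    by rewrite /K /invn mulrACA divfK ?mulfV ?mulr1 ?pnatr_eq0// gt_eqF.
  have [|w wr wmin] := @argmin_ball R n v rad
      (fun w => f w + K * normv (w - v) ^+ 2) (C + K * (2%:R * rad)) (ltW rad0).
    move=> a b ar br; have := fC a b ar br => F.
    have T := normv_tri a b v.
    have S : normv (a - v) ^+ 2 - normv (b - v) ^+ 2 <= 2%:R * rad * normv (a - b).
      rewrite subr_sqr mulrC; apply: (@le_trans _ _ ((normv (a - v) + normv (b - v)) * normv (a - b))).
        by rewrite ler_wpM2l ?addr_ge0 ?normv_ge0//; lra.
      by rewrite ler_wpM2r ?normv_ge0//; lra.
    have := ler_wpM2l (ltW K0) S; lra.
  have wv : K * normv (w - v) <= C.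
    have := wmin v; rewrite subrr normv0 expr0n/= mulr0 addr0 => /(_ (ltW rad0)) H.
    have vr : normv (v - v) <= rad by rewrite subrr normv0 ltW.
    have := fC _ _ vr wr; rewrite (normvBC v) => H2.
    have [->|] := eqVneq (w - v) 0; first by rewrite normv0 mulr0.
    by rewrite -normv_gt0 => wv0; rewrite -(ler_pM2r wv0); lra.
  have wlt : normv (w - v) < rad * invn k by rewrite -(ltr_pM2l K0); lra.
  have wrad : normv (w - v) < rad.
    apply: lt_le_trans wlt _; rewrite ler_piMr ?(ltW rad0)//.
    by rewrite /invn invf_le1// ler1n.
  exists (w, (2%:R * K) *: (v - w)); split=> /=; first exact: ltW.
    have K2 : 0 <= 2%:R * K by lra.
    by rewrite (normvZ_ge0 _ K2) (normvBC v); lra.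
  have Lw : L * normv (w - v) < del0 - normv (x - xb).
    by apply: le_lt_trans radd; rewrite ler_wpM2l ?ltW.
  have Gw : G (xb + P w) w by apply: gph_near xd Gxv (inb _ wr) Lw.
  split; first exact/gph_pair.
  move=> e e0.
  pose s := Num.min (rad - normv (w - v))
     (Num.min (del0 - normv (xb + P w - xb)) (e / K)).
  have wd : normv (xb + P w - xb) < del0.
    rewrite addrC addKr; have := PL (inb _ wr) ve; have := normv_triB (P w) (P v).
    have xP : x - xb = P v by rewrite {1}xE addrC addKr.
    by move: Lw; rewrite xP; lra.
  exists s; split; first by rewrite !lt_min !subr_gt0 wrad wd divr_gt0.
  move=> z [x' [w' [-> G']]] _; rewrite pairvB => zs.
  have := le_lt_trans (normv_pairl _ _) zs; have := le_lt_trans (normv_pairr _ _) zs.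
  rewrite !lt_min => /and3P[wr' _ we] /and3P[_ xd' _].
  have Tw := normv_tri w' w v; have Tx := normv_tri x' (xb + P w) xb.
  have x'd : normv (x' - xb) < del0 by lra.
  have w'r : normv (w' - v) <= rad by lra.
  have [_ x'E] := iffLR (GP _ x'd) G'.
  have := wmin _ w'r.
  rewrite dotv_pair x'E addBl /f.
  have -> : normv (w' - v) ^+ 2 = normv (w - v) ^+ 2 +
      2%:R * dotv (w - v) (w' - w) + normv (w' - w) ^+ 2.
    have -> : w' - v = (w - v) + (w' - w) by rewrite [RHS]addrC addrA subrK.
    by rewrite !normv_sqr; move: (w - v) (w' - w) => a b; rewrite !dotvE (dotvC b a); ring.
  move: we; rewrite ltr_pdivlMr// => we.
  have := ler_wpM2r (normv_ge0 (w' - w)) (ltW we).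
  have := ler_wpM2l (ltW e0) (normv_pairr (P w' - P w) (w' - w)).
  rewrite !dotvE; lra.
have [|s [d [sk dcv]]] := @bolzano_weierstrass _ _ (fun k => (vb k).2) (2%:R * C).
  by move=> k; case: (hvb k).
exists d; rewrite /coderiv opprK.
exists (fun k => pairv (xb + P (vb (s k)).1) (vb (s k)).1),
  (fun k => pairv (- v) (vb (s k)).2).
have v1cv : cvgv (fun k => (vb (s k)).1) v.
  apply: (@cvgv_sub _ _ (fun k => (vb k).1)) => // e e0.
  have [|N hN] := @invn_lt R (e / rad); first by rewrite divr_gt0.
  exists N => k /hN; rewrite ltr_pdivlMr// mulrC => kN.
  by apply: le_lt_trans kN; case: (hvb k).
split; first by move=> k; case: (hvb (s k)) => _ _ [].
split; [|split].
- apply: cvgv_pair => // e e0.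
  have [|N hN] := v1cv (e / L); first by rewrite divr_gt0.
  exists N => k /hN; rewrite ltr_pdivlMr// mulrC => kN.
  rewrite xE addBl; apply: le_lt_trans kN; apply: PL => //.
  apply: inb; have [+ _ _] := hvb (s k) => /le_trans; apply.
  by rewrite ler_piMr ?(ltW rad0)// /invn invf_le1// ler1n.
- apply: cvgv_pair => //; exact: cvgv_cst.
- by move=> k; case: (hvb (s k)).
Qed.

(** The difference quotients of P at v in direction - v are bounded by L |v|, and any cluster point
    is a direction. *)
Lemma graphical_step_exists x v : normv (x - xb) < del0 -> G x v ->
  exists d, graphD G x v d (- v).
Proof.
have Lp := L0; move=> xd Gxv; have [ve xE] := iffLR (GP _ xd) Gxv.
pose C := L * normv v + 1.
have C1 : 1 <= C by rewrite /C lerDr mulr_ge0 ?normv_ge0// ltW.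
(* Bounds all step lengths, so that every w k = (1 - t k) v remains in the domain and its graph
   point near xb. *)
pose c := Num.min 1 ((del0 - normv (x - xb)) / (2%:R * C)).
have c0 : 0 < c by rewrite lt_min ltr01 divr_gt0 ?subr_gt0//; lra.
have cC : c * C < del0 - normv (x - xb).
  have : c <= (del0 - normv (x - xb)) / (2%:R * C) by rewrite ge_min lexx orbT.
  rewrite ler_pdivlMr; last by lra.
  move: xd; rewrite -subr_gt0; lra.
have c1 : c <= 1 by rewrite ge_min lexx.
pose t k := c * invn k.
have tk k : 0 < t k <= c.
  rewrite mulr_gt0 ?invn_gt0//= ler_piMr ?(ltW c0)//.
  by rewrite /invn invf_le1// ler1n.
pose w k := v + t k *: (- v).
have wE k : w k = (1 - t k) *: v by rewrite /w scalerBl scale1r scalerN.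
have wv k : w k - v = t k *: (- v) by rewrite /w addrC addKr.
have we k : normv (w k) < eta.
  have /andP[t0 tc] := tk k; rewrite wE normvZ_ge0; last by lra.
  by apply: le_lt_trans ve; rewrite ler_piMl ?normv_ge0//; lra.
pose d k := (t k)^-1 *: (P (w k) - P v).
have Pd k : P (w k) - P v = t k *: d k.
  by have /andP[t0 _] := tk k; rewrite /d scalerA divff ?scale1r// gt_eqF.
have PwL k : normv (P (w k) - P v) <= t k * (L * normv v).
  have /andP[t0 _] := tk k.
  have := PL (we k) ve; rewrite wv (normvZ_ge0 _ (ltW t0)) normvN; lra.
have [|s [l [sk dcv]]] := @bolzano_weierstrass _ _ d (L * normv v).
  move=> k; have := PwL k; rewrite Pd; have /andP[t0 _] := tk k.
  by rewrite (normvZ_ge0 _ (ltW t0)) ler_pM2l.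
exists l, (t \o s), (fun k => pairv (d (s k)) (- v)); split; [split|split].
- by move=> k; have /andP[] := tk (s k).
- apply: cvgR_sub => // e e0.
  have [|N hN] := @invn_lt R (e / c); first by rewrite divr_gt0.
  exists N => k /hN; rewrite ltr_pdivlMr// mulrC subr0 gtr0_norm//.
  by have /andP[] := tk k.
- by apply: cvgv_pair => //; exact: cvgv_cst.
- move=> k; rewrite pairvDZ; apply/gph_pair => /=; rewrite -Pd -/(w _).
  have -> : x + (P (w (s k)) - P v) = xb + P (w (s k)).
    by rewrite xE addrACA subrr addr0.
  apply: (gph_near xd Gxv) => //; rewrite wv; have /andP[t0 tc] := tk (s k).
  rewrite (normvZ_ge0 _ (ltW t0)) normvN.
  have : t (s k) * C <= c * C by rewrite ler_wpM2r//; lra.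
  rewrite {1}/C; lra.
Qed.

End NewtonSteps.

(** * Superlinear convergence *)

Section Convergence.
Context {R : realType} {n : nat}.

Lemma is_grad_unique (F : 'rV[R]_n -> \bar R) x u v :
  is_grad F x u -> is_grad F x v -> u = v.
Proof.
move=> [a [xa hu]] [b [xb hv]]; move: hv; have [<-] : a%:E = b%:E by rewrite -xa.
move=> hv; apply/eqP; rewrite -subr_eq0 -normv_eq0 eq_le normv_ge0 andbT.
have [->|uv] := eqVneq (u - v) 0; first by rewrite normv0.
rewrite -normv_gt0 in uv.
apply: normv_le_of_small => // e e0; have e20 : 0 < e / 2%:R by lra.
have [d1 [d10 h1]] := hu _ e20; have [d2 [d20 h2]] := hv _ e20.
pose d := Num.min d1 d2.
have d0 : 0 < d by rewrite lt_min d10.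
pose t := d / 2%:R / normv (u - v).
have t0 : 0 < t by rewrite !divr_gt0.
have td : normv (t *: (u - v)) < d.
  by rewrite (normvZ_ge0 _ (ltW t0)) divfK ?gt_eqF//; lra.
exists t; split=> //.
have yx : x + t *: (u - v) - x = t *: (u - v) by rewrite addrC addKr.
move: td; rewrite lt_min => /andP[td1 td2].
have := h1 (x + t *: (u - v)); have := h2 (x + t *: (u - v)); rewrite yx.
move=> /(_ td2)[c [yc +]] /(_ td1)[c' [yc' +]].
have [<-] : c%:E = c'%:E by rewrite -yc.
move: (t *: (u - v)) => z; rewrite !ler_norml => /andP[h21 h22] /andP[h11 h12].
rewrite add0r dotvDl dotvNl; lra.
Qed.

(** With factor 1/2 the estimate makes the errors decay geometrically, so iterates stay where steps
    exist; convergence then makes every smaller factor eventually available. *)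
Lemma local_superlinear_convergence (step : 'rV[R]_n -> 'rV[R]_n -> Prop)
    (F : 'rV[R]_n -> \bar R) xb (del0 : R) : 0 < del0 ->
  (forall e : R, 0 < e -> exists2 del : R, 0 < del & forall x x',
     normv (x - xb) < del -> step x x' -> normv (x' - xb) <= e * normv (x - xb)) ->
  (forall x, normv (x - xb) < del0 ->
     exists g, is_grad F x g /\ (g != 0 -> exists y, step x y)) ->
  exists2 del : R, 0 < del & forall x0, normv (x0 - xb) <= del ->
    alg_well_defined step F x0 /\
    forall x : nat -> 'rV[R]_n, x 0%N = x0 -> (forall k, step (x k) (x k.+1)) ->
      Qsuperlinear x xb.
Proof.
move=> del00 est ex; have [|d d0 hd] := est (1 / 2%:R); first by lra.
exists (Num.min d del0 / 2%:R) => [|x0]; first by rewrite divr_gt0// lt_min d0.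
set del := _ / _; have del0' : 0 < del by rewrite divr_gt0// lt_min d0.
have [deld deldel0] : del < d /\ del < del0.
  have : Num.min d del0 <= d by rewrite ge_min lexx.
  have : Num.min d del0 <= del0 by rewrite ge_min lexx orbT.
  rewrite /del; lra.
move=> x0d.
have iter (x : nat -> 'rV[R]_n) k : x 0%N = x0 ->
    (forall j, (j < k)%N -> step (x j) (x j.+1)) ->
    normv (x k - xb) <= del / 2%:R ^+ k.
  move=> xx0; elim: k => [_|k IH st]; first by rewrite xx0 expr0 divr1.
  have {}IH : normv (x k - xb) <= del / 2%:R ^+ k.
    by apply: IH => j jk; apply: st; apply: leqW.
  have kd : normv (x k - xb) < d.
    apply: le_lt_trans IH _; apply: le_lt_trans deld.
    by rewrite ler_piMr ?(ltW del0')// invf_le1 ?exprn_gt0// exprn_ege1// ler1n.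
  apply: le_trans (hd _ _ kd (st k (ltnSn k))) _.
  by rewrite exprS invfM mulrCA mul1r ler_wpM2l ?invr_ge0.
have lim (x : nat -> 'rV[R]_n) : x 0%N = x0 -> (forall k, step (x k) (x k.+1)) ->
    cvgv x xb.
  move=> xx0 st e e0; have [|N hN] := @invn_lt R (e / del); first by rewrite divr_gt0.
  exists N => k /hN; rewrite ltr_pdivlMr// mulrC; apply: le_lt_trans.
  apply: le_trans (iter x k xx0 _) _ => //; rewrite ler_wpM2l ?(ltW del0')//.
  by rewrite /invn lef_pV2 ?posrE ?exprn_gt0// -natrX ler_nat ltn_expl.
split=> [x k xx0 st|x xx0 st].
  apply: ex; apply: le_lt_trans (iter x k xx0 st) _; apply: le_lt_trans deldel0.
  by rewrite ler_piMr ?(ltW del0')// invf_le1 ?exprn_gt0// exprn_ege1// ler1n.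
split; first exact: lim.
move=> e e0; have [d' d'0 hd'] := est e e0.
have [N hN] := lim x xx0 st _ d'0.
by exists N => k /hN kd; apply: hd'.
Qed.

End Convergence.

(** * Tilt stability and the Moreau envelope *)

Section MoreauTilt.
Context {R : realType} {n : nat}.
Variables (phi : 'rV[R]_n -> \bar R) (xb : 'rV[R]_n) (kappa gamma eta ab rho : R).
Variable m : 'rV[R]_n -> 'rV[R]_n.
Hypotheses (kappa0 : 0 < kappa) (gamma0 : 0 < gamma) (eta0 : 0 < eta) (rho0 : 0 <= rho).
Hypothesis phiN : forall x, phi x != -oo%E.
Hypothesis phixb : phi xb = ab%:E.
Hypothesis tilt : forall v, normv v < eta -> forall x, Mtilt phi xb gamma v x <-> x = m v.
Hypothesis mL : forall v w, normv v < eta -> normv w < eta ->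
  normv (m v - m w) <= kappa * normv (v - w).
Hypothesis m0 : m 0 = xb.

(* g is, up to the shift by xb, the conjugate of phi restricted to the ball of
   radius gamma; mt v is its subgradient at v. *)
Let f v := fine (phi (m v)).
Let mt v := m v - xb.
Let g v := dotv v (mt v) - f v.

Lemma tilt_in_ball v : normv v < eta -> normv (m v - xb) <= gamma.
Proof. by move=> ve; have [] := iffRL (tilt ve (m v)) erefl. Qed.

(** Comparison with xb, where phi is finite, excludes the value +oo at the minimiser. *)
Lemma tilt_value v : normv v < eta -> phi (m v) = (f v)%:E.
Proof.
move=> ve; have [_ /(_ xb)] := iffRL (tilt ve (m v)) erefl.
rewrite subrr normv0 phixb => /(_ (ltW gamma0)); rewrite /f.
by have := phiN (m v); case: (phi (m v)).
Qed.

Lemma tilt_le v y b : normv v < eta -> normv (y - xb) <= gamma -> phi y = b%:E ->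
  f v + dotv v (y - m v) <= b.
Proof.
move=> ve yg yb; have [_ /(_ y yg)] := iffRL (tilt ve (m v)) erefl.
rewrite tilt_value// yb !lee_fin !dotvE; lra.
Qed.

Lemma tilt_lipschitz v w : normv v < eta -> normv w < eta ->
  normv (mt v - mt w) <= kappa * normv (v - w).
Proof. by move=> ve we; rewrite /mt opprB addrA subrK mL. Qed.

Lemma tilt0 : mt 0 = 0.
Proof. by rewrite /mt m0 subrr. Qed.

Lemma tilt_subgradient v w : normv v < eta -> normv w < eta ->
  g v + dotv (mt v) (w - v) <= g w.
Proof.
move=> ve we; have := tilt_le we (tilt_in_ball ve) (tilt_value ve).
rewrite /g /mt !dotvE (dotvC (m v) w) (dotvC (m v) v) (dotvC xb w) (dotvC xb v); lra.
Qed.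

Lemma zero_lt_eta : normv (0 : 'rV[R]_n) < eta.
Proof. by rewrite normv0. Qed.

Lemma tilt_le0 v : normv v < eta -> normv (mt v) <= kappa * normv v.
Proof.
by move=> ve; have := tilt_lipschitz ve zero_lt_eta; rewrite tilt0 !subr0.
Qed.

(** An interior minimiser of the tilted function makes (v, -1) a regular normal to the epigraph, so
    constant sequences suffice. *)
Lemma subdiff_tilt v : normv v < eta -> normv (mt v) < gamma -> subdiff phi (m v) v.
Proof.
move=> ve mg; exists (f v); split; first exact: tilt_value.
exists (fun=> pairv (m v) (const_mx (f v))), (fun=> pairv v (const_mx (-1))).
have epiv : epi phi (pairv (m v) (const_mx (f v))).
  by exists (m v), (f v); rewrite tilt_value.
split=> //; split; first exact: cvgv_cst.
split=> [|_]; first exact: cvgv_cst.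
split=> // e e0; exists (gamma - normv (mt v)); split; first by rewrite subr_gt0.
move=> _ [y [c [-> yc]]] _; rewrite pairvB => H.
have {}H := le_lt_trans (normv_pairl _ _) H.
have yg : normv (y - xb) <= gamma by have := normv_tri y (m v) xb; rewrite -/(mt v); lra.
have [b yb] : exists b, phi y = b%:E.
  by have := phiN y; move: yc; case: (phi y) => // b; exists b.
have := tilt_le ve yg yb; move: yc; rewrite yb lee_fin => bc T.
apply: (@le_trans _ _ 0); last by rewrite mulr_ge0 ?normv_ge0 ?ltW.
rewrite dotv_pair {2}/dotv big_ord1 !mxE; lra.
Qed.

(** For (u, v) near (xb, 0), solve mt v' + r v' = (u - xb) + r v, so that m v' - u = r (v - v').
    Prox-regularity at (u, v) and minimality of m v' together give r |v - v'|^2 <= rho' / 2 r^2 |v -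
    v'|^2, and r rho' < 1 forces v' = v. *)
Lemma subdiff_local_graph (eps rho' : R) : 0 < eps -> 0 <= rho' ->
  (forall x u v (a : R), normv (x - xb) <= eps ->
     normv (pairv u v - pairv xb 0) <= eps -> subdiff phi u v -> phi u = a%:E ->
     ((a + dotv v (x - u) - rho' / 2%:R * normv (x - u) ^+ 2)%:E <= phi x)%E) ->
  exists2 e0 : R, 0 < e0 & forall u v, normv (u - xb) < e0 -> normv v < e0 ->
    subdiff phi u v -> normv v < eta /\ u = m v.
Proof.
have kp := kappa0; have ep := eta0; have gp := gamma0.
move=> eps0 rho'0 prox; pose r := (rho' + 1)^-1.
have r0 : 0 < r by rewrite invr_gt0; lra.
have rE : r * (rho' + 1) = 1 by rewrite mulVf// gt_eqF//; lra.
(* The bounds keep v in the domain of m, the equation for v' solvable, u in the tilt ball, and (u,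
   v) and m v' in the prox-regularity ball. *)
pose e0 := Num.min (Num.min (eta / 2%:R) (r * eta / (4%:R * (1 + r))))
   (Num.min gamma (Num.min (eps / 2%:R) (r * eps / (kappa * (1 + r))))).
have e00 : 0 < e0.
  have r1 : 0 < 1 + r by lra.
  have e4 : 0 < (4%:R : R) by [].
  by rewrite !lt_min !divr_gt0 ?gp ?mulr_gt0.
exists e0 => // u v ue0 ve0 uv.
have : e0 <= e0 by []; rewrite {2}/e0 !le_min.
have r1 : 0 < 4%:R * (1 + r) by lra.
have r2 : 0 < kappa * (1 + r) by rewrite mulr_gt0//; lra.
rewrite (ler_pdivlMr _ _ r1) (ler_pdivlMr _ _ r2).
move=> /andP[/andP[ee1 ee2] /and3P[eg eps2 eps3]].
have ve : normv v < eta by lra.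
pose z := (u - xb) + r *: v.
have zr : normv z <= (1 + r) * e0.
  apply: le_trans (normvD _ _) _; rewrite (normvZ_ge0 _ (ltW r0)).
  have : r * normv v <= r * e0 by rewrite ler_wpM2l ?ltW.
  lra.
have zr' : normv z < (1 + r) * e0.
  apply: le_lt_trans (normvD _ _) _; rewrite (normvZ_ge0 _ (ltW r0)).
  have : r * normv v <= r * e0 by rewrite ler_wpM2l ?ltW.
  lra.
have [|v' v'e zE] := @shift_map_surjective R n mt g kappa eta r kappa0 eta0 r0 tilt0
  tilt_lipschitz tilt_subgradient z; first by lra.
have w1 := tilt_le0 v'e.
have w2 := @shift_map_le R n mt g eta r eta0 tilt0 tilt_subgradient v' v'e.
rewrite zE in w2.
have weps : normv (m v' - xb) <= eps.
  rewrite -(ler_pM2l r0); have := ler_wpM2l (ltW r0) w1.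
  have := ler_wpM2l (ltW kp) w2; have := ler_wpM2l (ltW kp) zr; rewrite -/(mt v'); lra.
have [a [ua _]] := uv.
have uveps : normv (pairv u v - pairv xb 0) <= eps.
  rewrite pairvB subr0; apply: le_trans (normv_pair_le _ _) _; lra.
have := prox _ _ _ _ weps uveps uv ua; rewrite tilt_value// lee_fin.
have ug : normv (u - xb) <= gamma by lra.
have := tilt_le v'e ug ua.
have wu : m v' - u = r *: (v - v').
  move: zE; rewrite /z /shift_map /mt => /rowP zE; apply/rowP => i.
  have := zE i; rewrite !mxE; lra.
rewrite -opprB wu (normvZ_ge0 _ (ltW r0)) => T1 T2.
have D := normv_sqr (v - v').
have T3 : r * normv (v - v') ^+ 2 <= rho' / 2%:R * (r * normv (v - v')) ^+ 2.
  by rewrite D; move: T1 T2; rewrite !dotvE; lra.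
have N0 : normv (v - v') ^+ 2 <= 0.
  have := sqr_ge0 (normv (v - v')); move: T3; rewrite exprMn [r ^+ 2]expr2.
  move: (normv _ ^+ 2) => N T3 N0.
  have {T3} : N <= rho' / 2%:R * (r * N) by rewrite -(ler_pM2l r0); lra.
  have : rho' * r * N <= N.
    have -> : rho' * r * N = N - r * N.
      have : r * (rho' + 1) * N = N by rewrite rE mul1r.
      lra.
    by rewrite gerBl mulr_ge0// ltW.
  lra.
have vv' : v - v' = 0.
  by apply/eqP; rewrite -normv_eq0 -sqrf_eq0 eq_le N0 sqr_ge0.
split=> //; move: wu; rewrite vv' scaler0 => /eqP; rewrite subr_eq0 => /eqP <-.
by congr m; apply/eqP; rewrite -subr_eq0 -oppr_eq0 opprB vv'.
Qed.

(** Locally the graph of the subdifferential is the set of points (m v, v), so (a, b) is a regular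
    normal to it and the uniform form of semismoothness applies. *)
Lemma semismooth_normals (e0 : R) : 0 < e0 ->
  (forall u v, normv (u - xb) < e0 -> normv v < e0 -> subdiff phi u v ->
     normv v < eta /\ u = m v) ->
  semismooth_star (subdiff phi) xb 0 ->
  forall e : R, 0 < e -> exists2 del : R, 0 < del &
  forall v a b (C d : R), normv v < del -> 0 <= C -> 0 < d ->
    (forall v', normv (v' - v) < d ->
       dotv a (mt v' - mt v) + dotv b (v' - v) <= C * normv (v' - v) ^+ 2) ->
    `|dotv a (mt v) + dotv b v| <= e * normv a * normv v.
Proof.
have kp := kappa0; have ep := eta0.
move=> e00 loc ss e epos; pose k1 := 1 + kappa.
have k10 : 0 < k1 by rewrite /k1; lra.
have ss' d a : Ndir (gph (subdiff phi)) (pairv xb 0) d a -> dotv a d = 0.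
  rewrite -[d]hsubmxK -[a]hsubmxK => H.
  have := ss (lsubmx d) (rsubmx d) (lsubmx a) (- rsubmx a).
  rewrite /coderiv_dir opprK => /(_ H); rewrite -!/(pairv _ _) dotv_pair dotvNl => ->.
  by rewrite addNr.
(* One factor k1 pays for |(a, b)| <= k1 |a|, the other for |(mt v, v)| <= k1 |v|. *)
have ek0 : 0 < e / k1 ^+ 2 by rewrite divr_gt0// exprn_gt0.
have [del del0 hdel] := Ndir_uniform ss' ek0.
exists (Num.min (Num.min (del / k1) eta) (Num.min (gamma / k1) (e0 / (2%:R * k1)))) => [|v a b C d].
  by rewrite !lt_min ep !divr_gt0// mulr_gt0.
rewrite !lt_min => /andP[/andP[vd ve] /andP[vg ve0]] C0 dpos H.
have k2 : 0 < 2%:R * k1 by lra.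
move: vd vg ve0; rewrite (ltr_pdivlMr _ _ k10) (ltr_pdivlMr _ _ k10) (ltr_pdivlMr _ _ k2).
move=> vd vg ve0.
have w1 := tilt_le0 ve; have vn0 := normv_ge0 v.
have kv : kappa * normv v = normv v * k1 - normv v by rewrite /k1; ring.
have vk := mulr_ge0 vn0 (ltW k10).
(* Testing the normal inequality along b itself, the Lipschitz bound on m lets a control b. *)
have ba : normv b <= kappa * normv a.
  apply: normv_le_of_small => [|eps eps0]; first by rewrite mulr_ge0 ?normv_ge0 ?ltW.
  have [->|b0] := eqVneq b 0.
    by exists 1; rewrite scaler0 dotv0 normv0 mulr0.
  rewrite -normv_gt0 in b0.
  pose s := Num.min (Num.min d (eta - normv v)) (eps / (C + 1)).
  have s0 : 0 < s by rewrite !lt_min dpos subr_gt0 ve divr_gt0//; lra.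
  pose t := s / 2%:R / normv b.
  have t0 : 0 < t by rewrite !divr_gt0.
  have ts : normv (t *: b) < s.
    by rewrite (normvZ_ge0 _ (ltW t0)) divfK ?gt_eqF//; lra.
  exists t; split=> //.
  move: ts; rewrite !lt_min => /andP[/andP[td te]].
  have C1 : 0 < C + 1 by lra.
  rewrite ltr_pdivlMr// => tC.
  have v'v : (v + t *: b) - v = t *: b by rewrite addrC addKr.
  have v'e : normv (v + t *: b) < eta by have := normvD v (t *: b); lra.
  have := H (v + t *: b); rewrite v'v => /(_ td).
  have M := tilt_lipschitz v'e ve; rewrite v'v in M.
  have := le_trans (normr_dotv a _) (ler_wpM2l (normv_ge0 a) M).
  rewrite ler_norml => /andP[A _].
  have := ler_wpM2r (normv_ge0 (t *: b)) (ltW tC).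
  have := sqr_ge0 (normv (t *: b)); lra.
have N : Nhat (gph (subdiff phi)) (pairv (m v) v) (pairv a b).
  split; first by exists (m v), v; split=> //; apply: subdiff_tilt => //; lra.
  move=> e' e'0.
  have C1 : 0 < C + 1 by lra.
  exists (Num.min (Num.min d (e0 / 2%:R)) (e' / (C + 1))); split.
    by rewrite !lt_min dpos !divr_gt0.
  move=> _ [u' [v' [-> uv']]] _; rewrite pairvB => z.
  have := le_lt_trans (normv_pairl _ _) z; have := le_lt_trans (normv_pairr _ _) z.
  rewrite !lt_min => /andP[/andP[vd' ve'] vC] /andP[/andP[_ ue'] _].
  have T1 := normv_tri u' (m v) xb; rewrite -/(mt v) in T1.
  have T2 := normv_triB v' v.
  have k1g : normv v <= normv v * k1 by rewrite ler_peMr// /k1; lra.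
  have [||v'e ->] := loc u' v' _ _ uv'; [lra|lra|].
  have := H v' vd'; rewrite dotv_pair.
  have -> : mt v' - mt v = m v' - m v by rewrite /mt opprB addrA subrK.
  move=> /le_trans; apply.
  move: vC; rewrite (ltr_pdivlMr _ _ C1) => vC.
  have := ler_wpM2r (normv_ge0 (v' - v)) (ltW vC).
  have := ler_wpM2l (ltW e'0) (normv_pairr (m v' - m v) (v' - v)).
  have := sqr_ge0 (normv (v' - v)); lra.
have nz : normv (pairv (m v) v - pairv xb 0) <= k1 * normv v.
  by rewrite pairvB subr0; apply: le_trans (normv_pair_le _ _) _; rewrite -/(mt v); lra.
have na : normv (pairv a b) <= k1 * normv a.
  by apply: le_trans (normv_pair_le _ _) _; rewrite /k1; lra.
have := hdel _ _ _ N => /(_ (le_lt_trans nz _)); rewrite mulrC => /(_ vd).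
rewrite pairvB subr0 dotv_pair => /le_trans; apply.
have ek : 0 <= e / k1 ^+ 2 by rewrite divr_ge0 ?exprn_ge0 ?ltW.
rewrite pairvB subr0 in nz.
apply: (@le_trans _ _ (e / k1 ^+ 2 * (k1 * normv a) * (k1 * normv v))).
  apply: ler_pM => //; [by rewrite (mulr_ge0 ek) ?normv_ge0|exact: normv_ge0|].
  by rewrite ler_wpM2l.
rewrite le_eqVlt; apply/orP; left; apply/eqP; field; lra.
Qed.

(** * Values and gradients of the envelope near xb *)

Section Envelope.
Variable r : R.
Hypotheses (r0 : 0 < r) (r_rho : r * rho <= 1 / 2%:R).
Hypothesis growth : forall x,
  (phi xb - (rho / 2%:R * normv (x - xb) ^+ 2)%:E <= phi x)%E.

Let P := shift_map mt r.

(** Inside the tilt ball, expanding the square |(y - m v) - r v|^2 cancels the tilt term <v, y - m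
    v>. The growth condition takes care of the points outside. *)
Lemma envelope_le v y b : normv v < eta -> normv (P v) <= gamma / 4%:R ->
  phi y = b%:E ->
  f v + r / 2%:R * normv v ^+ 2 <= b + (2%:R * r)^-1 * normv (y - (xb + P v)) ^+ 2.
Proof.
have rp := r0; have gp := gamma0; have rr := r_rho; have rhop := rho0.
move=> ve Pg yb; pose i := (2%:R * r)^-1.
have i0 : 0 < i by rewrite invr_gt0; lra.
have iE : i * r = 1 / 2%:R by rewrite /i; field; rewrite gt_eqF.
have near z c : normv (z - xb) <= gamma -> phi z = c%:E ->
    f v + r / 2%:R * normv v ^+ 2 <= c + i * normv (z - (xb + P v)) ^+ 2.
  move=> zg zc; have := tilt_le ve zg zc.
  have -> : z - (xb + P v) = (z - m v) - r *: v.
    by rewrite /P /shift_map /mt addrA [xb + _]addrC subrK opprD addrA.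
  rewrite !normv_sqr; move: (z - m v) => w.
  have -> : i * dotv (w - r *: v) (w - r *: v) =
      i * dotv w w - (i * r) * 2%:R * dotv v w + (i * r) * r * dotv v v.
    by rewrite !dotvE (dotvC w v); ring.
  rewrite iE; have := mulr_ge0 (ltW i0) (dotv_ge0 w); lra.
have [yg|yg] := leP (normv (y - xb)) gamma; first exact: near.
(* Outside the ball xb is an intermediate competitor: |P v| <= gamma / 4 leaves a quadratic gain of
   at least |y - xb|^2 / (4 r), and r rho <= 1/2 makes it exceed the possible loss in phi. *)
have xg : normv (xb - xb) <= gamma by rewrite subrr normv0 ltW.
apply: le_trans (near xb ab xg phixb) _.
have := growth y; rewrite phixb yb lee_fin => gy.
have -> : xb - (xb + P v) = - P v by rewrite opprD addrA subrr add0r.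
rewrite normvN; have T := normv_triB (y - xb) (P v); rewrite -addrA -opprD in T.
have s0 := normv_ge0 (P v).
move: (normv (P v)) (normv (y - xb)) (normv (y - (xb + P v))) Pg yg gy T s0 => s t N Pg yg gy T s0.
have N2 : (t - s) ^+ 2 <= N ^+ 2 by rewrite ler_sqr ?nnegrE; lra.
have t2 : 4%:R * s * t <= t ^+ 2 by rewrite expr2 ler_wpM2r//; lra.
have q : t ^+ 2 / 2%:R <= N ^+ 2 - s ^+ 2 by nra.
have {q}q := ler_wpM2l (ltW i0) q.
have : rho / 2%:R * t ^+ 2 <= i * (t ^+ 2 / 2%:R).
  have : rho <= i.
    have -> : rho = i * (2%:R * (r * rho)).
      have -> : i * (2%:R * (r * rho)) = (i * r) * (2%:R * rho) by ring.
      by rewrite iE; field.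
    by rewrite ler_piMr ?(ltW i0)//; lra.
  by have := sqr_ge0 t; nra.
rewrite -/i; lra.
Qed.

Lemma moreau_value v : normv v < eta -> normv (P v) <= gamma / 4%:R ->
  moreau r phi (xb + P v) = (f v + r / 2%:R * normv v ^+ 2)%:E.
Proof.
move=> ve Pg; apply/eqP; rewrite eq_le; apply/andP; split; last first.
  apply: le_ereal_inf_tmp => _ [y _ <-].
  have := phiN y; case yb: (phi y) => [b||]// _; last by rewrite addye ?leey.
  by rewrite -EFinD lee_fin; apply: envelope_le.
apply: ereal_inf_lbound; exists (m v) => //; rewrite tilt_value//.
have -> : m v - (xb + P v) = - (r *: v).
  by rewrite /P /shift_map /mt addrA [xb + _]addrC subrK opprD addrA subrr add0r.
rewrite -EFinD normvN (normvZ_ge0 _ (ltW r0)); congr (_ + _)%:E.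
by field; rewrite gt_eqF.
Qed.

(** Nearby points are xb + P w, and the minimality of m v and m w bounds the first-order remainder
    by <w - v, P w - P v>. Expansiveness makes |w - v| <= e. *)
Lemma moreau_grad v : normv v < eta ->
  normv (P v) < gamma / 4%:R -> normv (P v) < r * eta / 4%:R ->
  is_grad (moreau r phi) (xb + P v) v.
Proof.
move=> ve Pg Pe; exists (f v + r / 2%:R * normv v ^+ 2).
rewrite (moreau_value ve (ltW Pg)); split=> // e e0.
exists (Num.min (e * r) (Num.min (gamma / 4%:R - normv (P v)) (r * eta / 4%:R - normv (P v)))).
split; first by rewrite !lt_min mulr_gt0// !subr_gt0 Pg Pe.
move=> y; rewrite !lt_min => /and3P[yer yg ye].
have T := normv_triB (y - xb) (P v); rewrite -addrA -opprD in T.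
have [|w we wE] := @shift_map_surjective R n mt g kappa eta r kappa0 eta0 r0 tilt0
  tilt_lipschitz tilt_subgradient (y - xb); first by lra.
have yE : y = xb + P w by rewrite /P wE addrC subrK.
exists (f w + r / 2%:R * normv w ^+ 2); split.
  by rewrite yE moreau_value// /P wE; lra.
have yx : y - (xb + P v) = P w - P v by rewrite yE addBl.
rewrite yx in yer *.
have ex := @shift_map_expansive R n mt g eta r tilt_subgradient w v we ve.
have we' : normv (w - v) <= e by rewrite -(ler_pM2l r0); rewrite /P in yer; lra.
have T1 := tilt_le ve (tilt_in_ball we) (tilt_value we).
have T2 := tilt_le we (tilt_in_ball ve) (tilt_value ve).
have D := le_trans (dotv_le_norm (w - v) (P w - P v))
  (ler_wpM2r (normv_ge0 _) we').
have PE : P w - P v = (m w - m v) + r *: (w - v).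
  by rewrite /P shift_mapB /mt opprB addrA subrK.
have wv0 := mulr_ge0 (ltW r0) (dotv_ge0 (w - v)).
have eN : 0 <= e * normv (P w - P v) by rewrite mulr_ge0 ?normv_ge0 ?ltW.
rewrite ler_norml; move: D eN; move: (normv (P w - P v)) => N.
rewrite PE !normv_sqr; move: T1 T2 wv0; rewrite !dotvE.
rewrite (dotvC w v) => T1 T2 wv0 D eN; apply/andP; split; lra.
Qed.

Lemma moreau_grad_graph x v :
  normv (x - xb) < Num.min (gamma / 4%:R) (r * eta / 4%:R) ->
  is_grad (moreau r phi) x v <-> normv v < eta /\ x = xb + P v.
Proof.
rewrite lt_min => /andP[xg xe]; split=> [gx|[ve xE]]; last first.
  by move: xg xe; rewrite xE addrC addKr => *; apply: moreau_grad.
have [w we wE] := @shift_map_surjective R n mt g kappa eta r kappa0 eta0 r0 tilt0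
  tilt_lipschitz tilt_subgradient (x - xb) xe.
have xE : x = xb + P w by rewrite /P wE addrC subrK.
suff -> : v = w by [].
apply: (is_grad_unique gx); rewrite xE; apply: moreau_grad => //; rewrite /P wE//.
Qed.

End Envelope.

End MoreauTilt.

(** * Choice of the constants and application to both algorithms *)

Unset Implicit Arguments.

Theorem theorem6p2 (R : realType) (n : nat) (phi : 'rV[R]_n -> \bar R)
    (xb : 'rV[R]_n) (rho kappa : R) :
  (forall x, phi x != -oo%E) ->
  cont_prox_regular phi xb 0 ->
  0 <= rho ->
  (forall x, (phi xb - (rho / 2%:R * normv (x - xb) ^+ 2)%:E <= phi x)%E) ->
  0 < kappa ->
  tilt_stable phi xb kappa ->
  semismooth_star (subdiff phi) xb 0 ->
  exists rbar : R, 0 < rbar /\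
    forall r : R, 0 < r -> r < rbar ->
    exists delta : R, 0 < delta /\
      forall x0 : 'rV[R]_n, normv (x0 - xb) <= delta ->
        alg_well_defined (stepA (moreau r phi)) (moreau r phi) x0 /\
        alg_well_defined (stepB (moreau r phi)) (moreau r phi) x0 /\
        (forall x : nat -> 'rV[R]_n, x 0%N = x0 ->
           (forall k, stepA (moreau r phi) (x k) (x k.+1)) -> Qsuperlinear x xb) /\
        (forall x : nat -> 'rV[R]_n, x 0%N = x0 ->
           (forall k, stepB (moreau r phi) (x k) (x k.+1)) -> Qsuperlinear x xb).
Proof.
move=> phiN [_ [[ab phixb] [_ [[eps [rho' [eps0 [rho'0 prox]]]] _]]]] rho0 growth
  kappa0 [gamma [gamma0 [eta [eta0 [m [tilt [mL m0]]]]]]] ss.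
have [e0 e00 loc] := subdiff_local_graph kappa0 gamma0 eta0 phiN phixb tilt mL m0
  eps0 rho'0 prox.
have normals := semismooth_normals kappa0 gamma0 eta0 phiN phixb tilt mL m0 e00 loc ss.
set mt := fun v => m v - xb in normals.
pose g v := dotv v (mt v) - fine (phi (m v)).
have mt0 : mt 0 = 0 by exact: tilt0.
have mtL : forall v w, normv v < eta -> normv w < eta ->
    normv (mt v - mt w) <= kappa * normv (v - w) by exact: tilt_lipschitz.
have gsub : forall v w, normv v < eta -> normv w < eta ->
    g v + dotv (mt v) (w - v) <= g w.
  by move=> v w; apply: (tilt_subgradient gamma0 phiN phixb tilt).
(* This threshold ensures r rho <= 1/2; the summand 1 covers rho = 0. *)
exists (2%:R * rho + 1)^-1; split=> [|r r0]; first by rewrite invr_gt0; lra.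
rewrite -[r]invrK ltf_pV2 ?posrE ?invr_gt0//; last by lra.
rewrite invrK => rlt.
have r_rho : r * rho <= 1 / 2%:R.
  by have := ler_wpM2l (ltW r0) (ltW rlt); rewrite mulfV ?gt_eqF//; lra.
(* The first radius serves the envelope formula, the second the solvability of P v = x - xb. *)
pose del0 := Num.min (gamma / 4%:R) (r * eta / 4%:R).
have del00 : 0 < del0 by rewrite lt_min !divr_gt0// mulr_gt0.
pose P := shift_map mt r.
have kr0 : 0 < kappa + r by rewrite addr_gt0.
have PL := shift_map_lipschitz r0 mtL.
have Ple := @shift_map_le R n mt g eta r eta0 mt0 gsub.
have GP := @moreau_grad_graph R n phi xb kappa gamma eta ab rho m kappa0 gamma0 eta0
  rho0 phiN phixb tilt mL m0 r r0 r_rho growth.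
have nest := normal_estimate kappa0 eta0 mt0 mtL gsub normals (ltW r0).
have test := tangent_estimate kappa0 eta0 mt0 mtL normals (ltW r0).
have has_grad x : normv (x - xb) < del0 -> exists v, is_grad (moreau r phi) x v.
  move=> xd; have := xd; rewrite lt_min => /andP[_ xe].
  have [v ve vE] := shift_map_surjective kappa0 eta0 r0 mt0 mtL gsub xe.
  by exists v; apply/GP => //; rewrite -/mt vE addrC subrK.
have [||dA dA0 hA] := @local_superlinear_convergence R n (stepA (moreau r phi))
    (moreau r phi) xb _ del00.
- move=> e e'0.
  have [del d0 hd] := coderivative_step_estimate kr0 r0 del00 PL Ple GP nest e'0.
  exists del => // x x' xd [v [Gv [_ [d [cd ->]]]]]; exact: hd xd Gv cd.
- move=> x xd; have [v Gv] := has_grad x xd; exists v; split=> // v0.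
  have [d cd] := coderivative_step_exists kr0 PL GP xd Gv.
  by exists (x - d), v; split=> //; split=> //; exists d.
have [||dB dB0 hB] := @local_superlinear_convergence R n (stepB (moreau r phi))
    (moreau r phi) xb _ del00.
- move=> e e'0.
  have [del d0 hd] := graphical_step_estimate r0 del00 Ple GP test e'0.
  exists del => // x x' xd [v [Gv [_ [d [cd ->]]]]]; exact: hd xd Gv cd.
- move=> x xd; have [v Gv] := has_grad x xd; exists v; split=> // v0.
  have [d cd] := graphical_step_exists kr0 PL GP xd Gv.
  by exists (x + d), v; split=> //; split=> //; exists d.
exists (Num.min dA dB); split; first by rewrite lt_min dA0.
move=> x0; rewrite le_min => /andP[/hA[wA cA] /hB[wB cB]].
by [].
Qed.
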